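(* Let $P$ be an equilateral triangle, a square, a regular hexagon or a regular pentagon, and let $L'$ be the language of the folded outer billiard map $\hat T$ attached to $P$. Then $L'$ is the set of all finite factors of the periodic infinite words $z^\omega=zzz\cdots$ with $z\in Z$, where: \begin{itemize} \item if $P$ is a triangle, $Z=\bigcup_{n\in\mathbb N}\{1(21)^n,\ 1(21)^n1(21)^{n+1}\}$; \item if $P$ is the square, $Z=\bigcup_{n\in\mathbb N}\{12^n\}$; \item if $P$ is the regular hexagon, $Z=\bigcup_{n\in\mathbb N}\{23^n,\ 23^n23^{n+1}\}\cup\{1\}$; \item if $P$ is the regular pentagon, $Z$ is the union of $$\bigcup_{n\in\mathbb N}\{\sigma^n(1),\ \sigma^n(12)\},$$ $$\bigcup_{n,m\in\mathbb N}\{\psi^m(2),\ \psi^m(2223),\ \psi^m\circ\sigma^n(1),\ \psi^m\circ\sigma^n(12)\},$$ $$\bigcup_{n,m\in\mathbb N}\{\psi^m\circ\xi\circ\sigma^n(1),\ \psi^m\circ\xi\circ\sigma^n(12)\},$$ where $\sigma,\psi,\xi$ are the endomorphisms of the free group $F_3$ on $\{1,2,3\}$ given by $\sigma:\ 1\mapsto 1121211,\ 2\mapsto 111,\ 3\mapsto 3$; $\psi:\ 1\mapsto 2232232,\ 2\mapsto 232,\ 3\mapsto 2^{-1}$; $\xi:\ 1\mapsto 23222,\ 2\mapsto 2,\ 3\mapsto 3$. \end{itemize}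
   Context: Here $\mathbb N=\{0,1,2,\dots\}$. Outer billiard. Let $P\subset\mathbb R^2$ be a (compact, convex) regular polygon with $k$ vertices $A_0,\dots,A_{k-1}$ listed counterclockwise, and $\overline P=\mathbb R^2\setminus P$. Let $s_i$ be the central symmetry about $A_i$. Let $\sigma_1$ (a subset of the plane) be the union of the lines containing the sides of $P$, $\sigma_n=\bigcup_{i=0}^{k-1}s_i\sigma_{n-1}$ for $n\ge2$, and $Y=\bigcup_{n\ge1}\sigma_n$. For $M\in\overline P\setminus Y$ there are two half-lines from $M$ tangent to $P$; order them as $D,D'$ so that the oriented angle from $D$ to $D'$ (through $P$) is positive, and let $A^+(M)$ be the vertex of $P$ on $D$. The outer billiard map $T:\overline P\setminus Y\to\overline P\setminus Y$ sends $M$ to its reflection about the point $A^+(M)$. Let $V_i$ be the closed cone with apex $A_i$ which is the closure of $\{M: A^+(M)=A_i\}$; the $V_i$, $0\le i\le k-1$, are ordered counterclockwise, cover $\overline P$, and each point of $\overline P\setminus Y$ is in exactly one of them. Folded map and coding. Let $R$ be the rotation of angle $-2\pi/k$ about the center of $P$, so $R^iV_i=V_0$. For $y\in V_i\setminus Y$ let $n_y$ be the smallest nonnegative integer $n$ with $R^{n}V_i=V_0$ (so $n_y=i$). The map $\hat T:V_0\setminus Y\to V_0\setminus Y$ is $\hat T(x)=R^{n_{Tx}}Tx$. With $j=\lfloor (k+1)/2\rfloor$, the coding map $\eta:V_0\setminus Y\to\{1,\dots,j\}^{\mathbb N}$ is $\eta(x)=(n_{T(\hat T^i x)})_{i\in\mathbb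 N}$. The language $L'$ is the set of all finite words that occur as factors (blocks of consecutive letters) of $\eta(x)$ for some $x\in V_0\setminus Y$. A power $z^n$ of a word means $n$-fold concatenation; $z^0$ is the empty word. Images under the free group endomorphisms are read as reduced words. *)

(* Defs.v *)
(* The plane is R * R, for an arbitrary R : realType. *)
From HB Require Import structures.
From mathcomp Require Import all_boot all_order all_algebra.
From mathcomp Require Import all_classical all_reals.
From mathcomp Require Import topology normedtype trigo.

Set Implicit Arguments.
Unset Strict Implicit.
Unset Printing Implicit Defensive.

Import Order.TTheory GRing.Theory Num.Theory.
Import numFieldNormedType.Exports.

Local Open Scope classical_set_scope.
Local Open Scope ring_scope.

Section Plane.
Context {R : realType}.
Implicit Types (t : R) (M Q A B u v : R * R).

Definition rot t v : R * R :=
  (cos t * v.1 - sin t * v.2, sin t * v.1 + cos t * v.2).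

(* For u, v != 0, [0 < cross u v] iff the oriented angle from u to v lies in
   ]0, pi[ modulo 2 pi. *)
Definition cross u v : R := u.1 * v.2 - u.2 * v.1.

Definition central_symmetry A M : R * R := A + A - M.

Definition line A B : set (R * R) := [set A + t *: (B - A) | t in setT].

Definition half_line M u : set (R * R) :=
  [set M + t *: u | t in [set t | 0 <= t]].

End Plane.

Section OuterBilliard.
Context {R : realType}.
(* The regular k-gon of center c whose vertex A_0 is c + v (with v != 0). *)
Variables (k : nat) (c v : R * R).
Implicit Types (M Q u x y : R * R) (i n : nat).

(* Counterclockwise; indices are meant modulo k, the vertices being the
   [vertex i] with i < k. *)
Definition vertex i : R * R := c + rot (2 * pi * i%:R / k%:R) v.

Definition polygon : set (R * R) :=
  [set M | exists w : 'I_k -> R,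
     [/\ forall j, 0 <= w j, \sum_j w j = 1 & M = \sum_j w j *: vertex j]].

(* [sing_set n] is the set sigma_(n+1): sigma_1 is the union of the lines
   containing the sides. *)
Fixpoint sing_set n : set (R * R) :=
  if n is n'.+1 then
    \bigcup_(i in `I_k) (central_symmetry (vertex i) @` sing_set n')
  else \bigcup_(i in `I_k) line (vertex i) (vertex i.+1).

Definition singular : set (R * R) := \bigcup_n sing_set n.

Definition domain : set (R * R) := ~` polygon `\` singular.

(* The half-line from M with direction u is tangent to the polygon: it meets
   it, and the polygon lies on one side of the supporting line. *)
Definition tangent_dir M u : Prop :=
  [/\ u <> 0,
      half_line M u `&` polygon !=set0 &
      (forall Q, polygon Q -> 0 <= cross u (Q - M)) \/
      (forall Q, polygon Q -> cross u (Q - M) <= 0)].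

(* u and u' are directions of the two tangent half-lines D and D'. *)
Definition on_first_tangent M Q : Prop :=
  exists u u', [/\ tangent_dir M u, tangent_dir M u', 0 < cross u u' &
                   half_line M u Q].

(* The vertex A^+(M); meaningful for M in [domain], where it is unique. *)
Definition Aplus M : R * R :=
  xget M [set Q | on_first_tangent M Q /\ exists2 i, (i < k)%N & Q = vertex i].

Definition outer_billiard M : R * R := central_symmetry (Aplus M) M.

Definition cone i : set (R * R) :=
  closure [set M | domain M /\ Aplus M = vertex i].

Definition rotR M : R * R := c + rot (- (2 * pi / k%:R)) (M - c).

Definition folds y n : Prop :=
  exists2 i, (i < k)%N & cone i y /\ iter n rotR @` cone i = cone 0.

(* The number n_y; meaningful for y outside P and [singular]. *)
Definition fold_index y : nat :=
  xget 0%N [set n | folds y n /\ forall m, folds y m -> (n <= m)%N].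

Definition folded_map x : R * R :=
  iter (fold_index (outer_billiard x)) rotR (outer_billiard x).

Definition coding x : nat -> nat :=
  fun i => fold_index (outer_billiard (iter i folded_map x)).

End OuterBilliard.

Definition factors (A : Type) (s : nat -> A) : set (seq A) :=
  [set w | exists m, w = mkseq (fun i => s (m + i)%N) (size w)].

(* The language L'. *)
Definition language (R : realType) (k : nat) (c v : R * R) : set (seq nat) :=
  \bigcup_(x in cone k c v 0 `\` singular k c v) factors (coding k c v x).

Definition wpow (A : Type) (z : seq A) (n : nat) : seq A := flatten (nseq n z).

(* The infinite word z^omega, for z nonempty; the default value [point] of
   [nth] is then never reached. *)
Definition omega (A : pointedType) (z : seq A) : nat -> A :=
  fun i => nth point z (i %% size z).

Definition periodic_factors (A : pointedType) (Z : set (seq A)) : set (seq A) :=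
  \bigcup_(z in Z) factors (omega z).

Definition Z_triangle : set (seq nat) :=
  \bigcup_n [set 1%N :: wpow [:: 2; 1]%N n ;
                 (1%N :: wpow [:: 2; 1]%N n) ++
                 (1%N :: wpow [:: 2; 1]%N n.+1)].

Definition Z_square : set (seq nat) :=
  \bigcup_n [set 1%N :: wpow [:: 2]%N n].

Definition Z_hexagon : set (seq nat) :=
  \bigcup_n [set 2%N :: wpow [:: 3]%N n ;
                 (2%N :: wpow [:: 3]%N n) ++ (2%N :: wpow [:: 3]%N n.+1)]
  `|` [set [:: 1%N]].

(* Elements of the free group on A are represented by reduced words in signed
   letters: (a, true) stands for a and (a, false) for a^-1. *)
Section FreeGroup.
Variable A : eqType.
Implicit Types (a : A * bool) (w : seq (A * bool)).

Definition pos (s : seq A) : seq (A * bool) := [seq (g, true) | g <- s].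

Definition signed_inv a : A * bool := (a.1, ~~ a.2).

Definition winv w : seq (A * bool) := rev [seq signed_inv a | a <- w].

Definition reduce w : seq (A * bool) :=
  foldr (fun a w' =>
           if w' is b :: w'' then
             if b == signed_inv a then w'' else a :: w'
           else [:: a]) [::] w.

(* The endomorphism of the free group extending f, with reduced values. *)
Definition endo (f : A -> seq (A * bool)) w : seq (A * bool) :=
  reduce (flatten [seq if a.2 then f a.1 else winv (f a.1) | a <- w]).

End FreeGroup.

(* The generators 1, 2, 3 of F_3. *)
Inductive gen := x1 | x2 | x3.

Definition nat_of_gen (g : gen) : nat :=
  match g with x1 => 1 | x2 => 2 | x3 => 3 end.

Definition gen_of_nat (n : nat) : option gen :=
  match n with 1 => Some x1 | 2 => Some x2 | 3 => Some x3 | _ => None end.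

Lemma nat_of_genK : pcancel nat_of_gen gen_of_nat.
Proof. by case. Qed.

HB.instance Definition _ := Equality.copy gen (pcan_type nat_of_genK).

Definition sigma : seq (gen * bool) -> seq (gen * bool) :=
  endo (fun g => match g with
    | x1 => pos [:: x1; x1; x2; x1; x2; x1; x1]
    | x2 => pos [:: x1; x1; x1]
    | x3 => pos [:: x3]
    end).

Definition psi : seq (gen * bool) -> seq (gen * bool) :=
  endo (fun g => match g with
    | x1 => pos [:: x2; x2; x3; x2; x2; x3; x2]
    | x2 => pos [:: x2; x3; x2]
    | x3 => [:: (x2, false)]
    end).

Definition xi : seq (gen * bool) -> seq (gen * bool) :=
  endo (fun g => match g with
    | x1 => pos [:: x2; x3; x2; x2; x2]
    | x2 => pos [:: x2]
    | x3 => pos [:: x3]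
    end).

Definition Z_pentagon : set (seq (gen * bool)) :=
  \bigcup_n [set iter n sigma (pos [:: x1]) ; iter n sigma (pos [:: x1; x2])]
  `|` \bigcup_n \bigcup_m
        [set z | [\/ z = iter m psi (pos [:: x2]),
                     z = iter m psi (pos [:: x2; x2; x2; x3]),
                     z = iter m psi (iter n sigma (pos [:: x1])) |
                     z = iter m psi (iter n sigma (pos [:: x1; x2]))]]
  `|` \bigcup_n \bigcup_m
        [set iter m psi (xi (iter n sigma (pos [:: x1]))) ;
             iter m psi (xi (iter n sigma (pos [:: x1; x2])))].

(* Spelling of an element of F_3 with numerical letters, keeping the signs. *)
Definition spell (z : seq (gen * bool)) : seq (nat * bool) :=
  [seq (nat_of_gen a.1, a.2) | a <- z].

(* Main.v *)
(* Let l_i(M) be the signed distance from M to the line through the side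
   [A_i, A_(i+1)]. In the coordinates p = - l_(k-1) and q = l_0, the cone V_0 is
   {p, q > 0}, the folded map is affine with coefficients in Z[tau], where
   tau = 2 cos(2 pi / k), on each of finitely many open convex pieces, and Y is
   the set of the points where some l_i takes a value in 2 Z (in 2 Z[phi] for
   the pentagon, phi being the golden ratio).

   The map is renormalisable: a translation Psi of V_0 conjugates it to a first
   return map, whose return words are given by a substitution psi, so that points
   far from the polygon reduce to points close to it. Near the polygon there
   remain finitely many islands (polygons permuted by the map, with a periodic
   coding) and, for the pentagon, an invariant region D and a copy Xi(D) of it.
   The map on D is in turn conjugate to a first return map on the contracted
   region Sigma(D), with the substitution sigma. A finite word read in D is thus
   the factor of an image under a power of sigma of a word of two letters, and
   all the possible ones occur in the periodic words 1^omega and (12)^omega.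

   For the pentagon the letter 3 only occurs in the block 23, and the given
   endomorphism psi, which maps 2 to 232 and 3 to the inverse of 2, fixes 23: on
   words in 1, 2 and 23 it is a positive substitution.

   All the geometric verifications (conjugacies, coverings of V_0 and D,
   invariance of the islands) are inclusions of open convex polygons with
   coefficients in Z[phi]. They are decided by computation: in the plane an
   inconsistent family of open half-planes has an inconsistent subfamily of three
   elements. *)
From Stdlib Require Import BinInt.
From mathcomp Require Import all_boot all_order all_algebra.
From mathcomp Require Import ssrZ zify ring lra.
From mathcomp Require Import all_classical all_reals.
From mathcomp Require Import topology normedtype trigo lebesgue_measure.
Require Import Defs.

Set Implicit Arguments.
Unset Strict Implicit.
Unset Printing Implicit Defensive.

Import Order.TTheory GRing.Theory Num.Theory.
Import numFieldNormedType.Exports.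

Local Open Scope classical_set_scope.
Local Open Scope ring_scope.

(** * Open polygons with coefficients in Z[phi] *)

(* [(m, n)] stands for [m + n phi], where [phi ^ 2 = phi + 1]. *)
Definition zphi := (Z * Z)%type.

Definition z0 : zphi := (Z0, Z0).
Definition z1 : zphi := (Zpos xH, Z0).
Definition zadd (a b : zphi) : zphi := (Z.add a.1 b.1, Z.add a.2 b.2).
Definition zopp (a : zphi) : zphi := (Z.opp a.1, Z.opp a.2).
Definition zsub (a b : zphi) : zphi := zadd a (zopp b).
Definition zmul (a b : zphi) : zphi :=
  let t := Z.mul a.2 b.2 in
  (Z.add (Z.mul a.1 b.1) t,
   Z.add (Z.add (Z.mul a.1 b.2) (Z.mul a.2 b.1)) t).
Definition znorm (a : zphi) : Z :=
  Z.sub (Z.add (Z.mul a.1 a.1) (Z.mul a.1 a.2)) (Z.mul a.2 a.2).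
Definition zeq (a b : zphi) : bool := Z.eqb a.1 b.1 && Z.eqb a.2 b.2.

(* When [a.1] and [a.2] have opposite signs, [a] has the sign of [a.1] times
   that of its norm, because the conjugate of [phi] is negative. *)
Definition zpos (a : zphi) : bool :=
  if Z.leb 0 a.1 then
    if Z.leb 0 a.2 then Z.ltb 0 a.1 || Z.ltb 0 a.2 else Z.ltb 0 (znorm a)
  else Z.ltb 0 a.2 && Z.ltb (znorm a) 0.
Definition znneg (a : zphi) : bool := zeq a z0 || zpos a.

(* The inverse of [a] when its norm is 1 or -1. *)
Definition zinv (a : zphi) : zphi :=
  zmul (znorm a, Z0) (Z.add a.1 a.2, Z.opp a.2).

(* [Form a b c] is the affine form [a p + b q + c] in the coordinates (p, q). *)
Record form := Form { fa : zphi; fb : zphi; fc : zphi }.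

Definition fopp (f : form) := Form (zopp (fa f)) (zopp (fb f)) (zopp (fc f)).
Definition fsub (f g : form) :=
  Form (zsub (fa f) (fa g)) (zsub (fb f) (fb g)) (zsub (fc f) (fc g)).
Definition fscale (u : zphi) (f : form) :=
  Form (zmul u (fa f)) (zmul u (fb f)) (zmul u (fc f)).
Definition feq (f g : form) : bool :=
  [&& zeq (fa f) (fa g), zeq (fb f) (fb g) & zeq (fc f) (fc g)].
Definition fconst (c : zphi) := Form z0 z0 c.

Definition aff := (form * form)%type.
Definition aid : aff := (Form z1 z0 z0, Form z0 z1 z0).
Definition pull (g : aff) (f : form) : form :=
  Form (zadd (zmul (fa f) (fa g.1)) (zmul (fb f) (fa g.2)))
       (zadd (zmul (fa f) (fb g.1)) (zmul (fb f) (fb g.2)))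
       (zadd (zadd (zmul (fa f) (fc g.1)) (zmul (fb f) (fc g.2))) (fc f)).
Definition acomp (f g : aff) : aff := (pull g f.1, pull g f.2).
Definition aeq (f g : aff) : bool := feq f.1 g.1 && feq f.2 g.2.
Definition fdet (f g : form) : zphi :=
  zsub (zmul (fa f) (fb g)) (zmul (fb f) (fa g)).

Definition ainv (g : aff) : aff :=
  let d := zinv (fdet g.1 g.2) in
  let: (f1, f2) := g in
  (Form (zmul d (fb f2)) (zopp (zmul d (fb f1)))
        (zmul d (zsub (zmul (fb f1) (fc f2)) (zmul (fb f2) (fc f1)))),
   Form (zopp (zmul d (fa f2))) (zmul d (fa f1))
        (zmul d (zsub (zmul (fa f2) (fc f1)) (zmul (fa f1) (fc f2))))).

(* [fdet g h] f + [fdet h f] g + [fdet f g] h is constant. *)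
Definition fres (f g h : form) : zphi :=
  zadd (zadd (zmul (fdet g h) (fc f)) (zmul (fdet h f) (fc g)))
       (zmul (fdet f g) (fc h)).

(** A Farkas certificate: the three determinants are the weights of a nonnegative, nonzero
    combination of the forms that is a constant [<= 0]. *)
Definition infeasible3 (f g h : form) : bool :=
  [&& znneg (fdet g h), znneg (fdet h f), znneg (fdet f g),
      zpos (fdet g h) || zpos (fdet h f) || zpos (fdet f g)
    & znneg (zopp (fres f g h))].

Definition const_nonpos (f : form) : bool :=
  [&& zeq (fa f) z0, zeq (fb f) z0 & znneg (zopp (fc f))].

Fixpoint has_pairs (T : Type) (r : T -> T -> bool) (s : seq T) : bool :=
  if s is x :: s' then has (r x) s' || has_pairs r s' else false.

Fixpoint has_triples (T : Type) (r : T -> T -> T -> bool) (s : seq T) : bool :=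
  if s is x :: s' then has_pairs (r x) s' || has_triples r s' else false.

Definition infeasible (C : seq form) : bool :=
  has const_nonpos C ||
  has_triples (fun f g h => infeasible3 f g h || infeasible3 g f h) C.

(** Here [h] is the opposite of the form to deduce. If the deduction failed, [h] would only be known
    to be nonnegative, so the contradiction needs a positive weight on [f] or [g]. *)
Definition entails2 (f g h : form) : bool :=
  [&& znneg (fdet g h), znneg (fdet h f), znneg (fdet f g),
      zpos (fdet g h) || zpos (fdet h f)
    & znneg (zopp (fres f g h))].

Definition entails (C : seq form) (f : form) : bool :=
  [&& zeq (fa f) z0, zeq (fb f) z0 & zpos (fc f)] ||
  has_pairs (fun g h =>
    let f' := fopp f in entails2 g h f' || entails2 h g f') C.

Fixpoint prune (D C : seq form) : seq form :=
  if C is f :: C' then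
    if entails (D ++ C') f then prune D C' else prune (rcons D f) C'
  else D.

(** * Piecewise affine maps and their symbolic dynamics *)

Definition in_lattice (b : bool) (a : zphi) : bool := b || Z.eqb a.2 0.

(** A guess for the factor between two proportional linear parts, right when the coefficient of [l]
    that is inverted is a unit; [lattice_line] checks the result. *)
Definition ratio (f l : form) : zphi :=
  if zeq (fa l) z0 then zmul (fb f) (zinv (fb l))
  else zmul (fa f) (zinv (fa l)).

(* Whether [f] is a unit multiple of [l - 2 a] for some [a] in the lattice. *)
Definition lattice_line b (f l : form) : bool :=
  let u := ratio f l in
  let v := zinv u in
  let s := zsub (fc l) (zmul v (fc f)) in
  let a := (Z.div2 s.1, Z.div2 s.2) in
  [&& in_lattice b v, in_lattice b a, zeq (zmul u v) z1 &
      feq f (fscale u (fsub l (fconst (zadd a a))))].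

Definition lattice_form b (ls : seq form) (f : form) : bool :=
  has (lattice_line b f) ls.

Definition preserves_lattice b (ls : seq form) (g : aff) : bool :=
  all (fun l => lattice_form b ls (pull g l)) ls.

(* Removes the polygons of [Ls] one after the other from [C], cutting only
   along lattice lines. *)
Fixpoint covered b ls (Ls : seq (seq form)) (C : seq form) : bool :=
  infeasible C ||
  if Ls is L :: Ls' then
    if infeasible (C ++ L) then covered b ls Ls' C else
    (fix cut (D L : seq form) : bool :=
       if L is f :: L' then
         if entails D f then cut D L' else
         [&& lattice_form b ls f,
             covered b ls Ls' (prune [::] (fopp f :: D)) &
             cut (prune [::] (f :: D)) L']
       else true) C L
  else false.

Record piece := Piece { dom : seq form; mv : aff }.

Definition system := seq piece.

(** The default piece has the inconsistent condition [0 > 0], so no point follows a letter outside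
    the alphabet. *)
Definition piece_at (S : system) (a : nat) : piece :=
  nth (Piece [:: fconst z0] aid) S a.

Definition disjoint_pieces (S : system) : bool :=
  all (fun a => all (fun b =>
    (a == b) || infeasible (dom (piece_at S a) ++ dom (piece_at S b)))
      (iota 0 (size S))) (iota 0 (size S)).

Fixpoint itinerary_forms (S : system) (h : aff) (w : seq nat) : seq form :=
  if w is a :: w' then
    [seq pull h f | f <- dom (piece_at S a)] ++
    itinerary_forms S (acomp (mv (piece_at S a)) h) w'
  else [::].

Definition end_map (S : system) (h : aff) (w : seq nat) : aff :=
  foldl (fun h a => acomp (mv (piece_at S a)) h) h w.

Definition itinerary_ok S (C : seq form) h w : bool :=
  all (entails C) (itinerary_forms S h w).

Definition letter_image (psi : seq (seq nat)) (a : nat) : seq nat :=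
  nth [::] psi a.

Definition subst (psi : seq (seq nat)) (w : seq nat) : seq nat :=
  flatten [seq letter_image psi a | a <- w].

(* [Phi] conjugates [S] to a map induced by [S'], with return words [psi]. *)
Definition embeds (S S' : system) (Phi : aff) (psi : seq (seq nat)) : bool :=
  all (fun a =>
    itinerary_ok S' (dom (piece_at S a)) Phi (letter_image psi a) &&
    aeq (end_map S' Phi (letter_image psi a))
        (acomp Phi (mv (piece_at S a)))) (iota 0 (size S)).

Section Floors.
Variables (S S' : system) (Phi : aff) (psi : seq (seq nat)).

Definition floor_map (a r : nat) : aff :=
  ainv (end_map S' Phi (take r (letter_image psi a))).

Definition floor_forms a r : seq form :=
  [seq pull (floor_map a r) f | f <- dom (piece_at S a)].

(* The image, after [r] steps of [S'], of the image under [Phi] of the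
   [a]-th piece of [S]. *)
Definition floor_ a r : seq form := prune [::] (floor_forms a r).

Definition floors : seq (seq form) :=
  flatten [seq [seq floor_ a r | r <- iota 0 (size (letter_image psi a))]
             | a <- iota 0 (size S)].

Definition all_floors (p : nat -> nat -> bool) : bool :=
  all (fun a => all (p a) (iota 0 (size (letter_image psi a))))
      (iota 0 (size S)).

(** Computed data are verified rather than proved correct: that [ainv] gave an inverse, and that
    [prune] only dropped consequences of the forms it kept. *)
Definition tower b ls : bool :=
  embeds S S' Phi psi &&
  all_floors (fun a r =>
    [&& aeq (acomp (end_map S' Phi (take r (letter_image psi a)))
                   (floor_map a r)) aid,
        preserves_lattice b ls (floor_map a r) &
        all (entails (floor_ a r)) (floor_forms a r)]).

Definition tower_decreases (m : form) (delta : zphi) : bool :=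
  all_floors (fun a r => entails (floor_ a r)
    (fsub (fsub m (pull (floor_map a r) m)) (fconst delta))).

End Floors.

(** The number [n] is taken large enough for [n] passes along [z] to cut out all the points with the
    periodic coding; [island_ok] confirms this by invariance. *)
Definition island S (n : nat) (z : seq nat) : seq form :=
  prune [::] (itinerary_forms S aid (wpow z n)).

Definition island_ok S n z : bool :=
  let I := island S n z in
  itinerary_ok S I aid z &&
  all (entails I) [seq pull (end_map S aid z) f | f <- I].

Lemma In_cat (T : Type) (x : T) (s t : seq T) :
  List.In x (s ++ t) -> List.In x s \/ List.In x t.
Proof.
elim: s => [|y s IH] /=; first by right.
by move=> [->|/IH[]]; [left; left|left; right|right].
Qed.

Lemma all_In (T : Type) (p : pred T) (s : seq T) x :
  all p s -> List.In x s -> p x.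
Proof.
elim: s => //= y s IH /andP[py /IH{}IH] [<- //|]; exact: IH.
Qed.

(** * Soundness of the computations on polygons and itineraries *)

Section Semantics.
Variables (R : realFieldType) (phi : R).
Hypotheses (phi_gt0 : 0 < phi) (phi_sqr : phi ^+ 2 = phi + 1).
Implicit Types (u v : zphi) (f g h : form) (C : seq form) (x : R * R).

Definition zr (n : Z) : R := (int_of_Z n)%:~R.

Lemma zrD m n : zr (Z.add m n) = zr m + zr n.
Proof. by rewrite /zr -intrD -[in RHS]raddfD. Qed.

Lemma zrN n : zr (Z.opp n) = - zr n.
Proof. by rewrite /zr -mulrNz -[in RHS]raddfN. Qed.

Lemma zrM m n : zr (Z.mul m n) = zr m * zr n.
Proof. by rewrite /zr -intrM -[in RHS]rmorphM. Qed.

Lemma zr_gt0 n : Z.ltb 0 n -> 0 < zr n.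
Proof. by move=> n0; rewrite /zr ltr0z; lia. Qed.

Lemma zr_ge0 n : Z.leb 0 n -> 0 <= zr n.
Proof. by move=> n0; rewrite /zr ler0z; lia. Qed.

Definition ev u : R := zr u.1 + zr u.2 * phi.

Lemma evD u v : ev (zadd u v) = ev u + ev v.
Proof. by rewrite /ev !zrD; ring. Qed.

Lemma evN u : ev (zopp u) = - ev u.
Proof. by rewrite /ev !zrN; ring. Qed.

Lemma evB u v : ev (zsub u v) = ev u - ev v.
Proof. by rewrite evD evN. Qed.

Lemma evM u v : ev (zmul u v) = ev u * ev v.
Proof.
rewrite /ev /= !zrD !zrM; apply/eqP; rewrite -subr_eq0.
have -> : zr u.1 * zr v.1 + zr u.2 * zr v.2 +
    (zr u.1 * zr v.2 + zr u.2 * zr v.1 + zr u.2 * zr v.2) * phi -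
    (zr u.1 + zr u.2 * phi) * (zr v.1 + zr v.2 * phi) =
  zr u.2 * zr v.2 * (phi + 1 - phi ^+ 2) by ring.
by rewrite phi_sqr subrr mulr0.
Qed.

Lemma ev0 : ev z0 = 0.
Proof. by rewrite /ev mul0r addr0. Qed.

Lemma ev1 : ev z1 = 1.
Proof. by rewrite /ev mul0r addr0. Qed.

Lemma zeqP u v : zeq u v -> u = v.
Proof. by case: u v => [? ?] [? ?] /andP[/Z.eqb_eq /= -> /Z.eqb_eq /= ->]. Qed.

Lemma phi_gt1 : 1 < phi.
Proof. by have := phi_gt0; have := phi_sqr; nra. Qed.

Lemma ev_norm u : zr (znorm u) = ev u * (zr u.1 + zr u.2 * (1 - phi)).
Proof.
rewrite /ev /znorm -Z.add_opp_r !zrD zrN !zrM.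
have -> : (zr u.1 + zr u.2 * phi) * (zr u.1 + zr u.2 * (1 - phi)) =
  zr u.1 * zr u.1 + zr u.1 * zr u.2 - zr u.2 * zr u.2 * (phi ^+ 2 - phi).
  by ring.
by rewrite phi_sqr; ring.
Qed.

Lemma zpos_gt0 u : zpos u -> 0 < ev u.
Proof.
rewrite /zpos; have phi1 := phi_gt1; case: ifP => [/zr_ge0 a1|a1].
  case: ifP => [/zr_ge0 a2|a2].
    move=> /orP[/zr_gt0|/zr_gt0] ? ; rewrite /ev; nra.
  move/zr_gt0; rewrite ev_norm => N0.
  have {}a2 : 0 < zr (Z.opp u.2) by apply: zr_gt0; lia.
  rewrite zrN in a2; rewrite -(pmulr_lgt0 _ (x := zr u.1 + zr u.2 * (1 - phi))) //.
  by nra.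
move=> /andP[/zr_gt0 a2 N0].
have {}N0 : 0 < zr (Z.opp (znorm u)) by apply: zr_gt0; lia.
have {}a1 : 0 < zr (Z.opp u.1) by apply: zr_gt0; lia.
rewrite zrN in a1; rewrite zrN ev_norm -mulrN in N0.
by rewrite -(pmulr_lgt0 _ (x := - (zr u.1 + zr u.2 * (1 - phi)))) //; nra.
Qed.

Lemma znneg_ge0 u : znneg u -> 0 <= ev u.
Proof. by case/orP=> [/zeqP ->|/zpos_gt0/ltW //]; rewrite ev0. Qed.

Definition fev f x : R := ev (fa f) * x.1 + ev (fb f) * x.2 + ev (fc f).

Definition aev (g : aff) x : R * R := (fev g.1 x, fev g.2 x).

Lemma fev_opp f x : fev (fopp f) x = - fev f x.
Proof. by rewrite /fev !evN; ring. Qed.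

Lemma fev_sub f g x : fev (fsub f g) x = fev f x - fev g x.
Proof. by rewrite /fev !evB; ring. Qed.

Lemma fev_scale u f x : fev (fscale u f) x = ev u * fev f x.
Proof. by rewrite /fev !evM; ring. Qed.

Lemma fev_const c x : fev (fconst c) x = ev c.
Proof. by rewrite /fev !ev0; ring. Qed.

Lemma fev_pull (g : aff) f x : fev (pull g f) x = fev f (aev g x).
Proof. by rewrite /fev /aev /fev /= !evD !evM; ring. Qed.

Lemma aev_comp (f g : aff) x : aev (acomp f g) x = aev f (aev g x).
Proof. by rewrite /aev /acomp /= !fev_pull. Qed.

Lemma aev_id x : aev aid x = x.
Proof. by case: x => p q; rewrite /aev /fev /= ev0 ev1; congr pair; ring. Qed.

Lemma feqP f g : feq f g -> f = g.
Proof.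
by case: f g => [? ? ?] [? ? ?] /and3P[/zeqP /= -> /zeqP /= -> /zeqP /= ->].
Qed.

Lemma aeqP (f g : aff) : aeq f g -> f = g.
Proof. by case: f g => [? ?] [? ?] /andP[/feqP /= -> /feqP /= ->]. Qed.

Lemma fev_res f g h x :
  ev (fdet g h) * fev f x + ev (fdet h f) * fev g x + ev (fdet f g) * fev h x =
  ev (fres f g h).
Proof. by rewrite /fres /fev /fdet; rewrite !(evD, evB, evM); ring. Qed.

Definition sat C x : Prop := forall f, List.In f C -> 0 < fev f x.

Lemma sat_nil x : sat [::] x.
Proof. by []. Qed.

Lemma sat_cons f C x : sat (f :: C) x <-> 0 < fev f x /\ sat C x.
Proof.
split=> [H|[fx Cx] g /= [<- //|/Cx //]].
by split=> [|g gC]; apply: H; [left|right].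
Qed.

Lemma sat_cat C C' x : sat (C ++ C') x <-> sat C x /\ sat C' x.
Proof.
elim: C => [|f C IH] /=; first by split=> [?|[]//]; split.
by rewrite !sat_cons IH; tauto.
Qed.

Lemma sat_pull (g : aff) C x : sat [seq pull g f | f <- C] x <-> sat C (aev g x).
Proof.
elim: C => [|f C IH] /=; first by split=> _; apply: sat_nil.
by rewrite !sat_cons IH fev_pull.
Qed.

Lemma sat_all (p : form -> bool) C x :
  (forall f, p f -> 0 < fev f x) -> all p C -> sat C x.
Proof.
move=> pf; elim: C => [|f C IH] /=; first by move=> _; apply: sat_nil.
by move=> /andP[/pf fx /IH Cx]; rewrite sat_cons.
Qed.

Lemma infeasible3_sound f g h x :
  infeasible3 f g h -> 0 < fev f x -> 0 < fev g x -> 0 < fev h x -> False.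
Proof.
move=> /and5P[/znneg_ge0 a /znneg_ge0 b /znneg_ge0 c abc].
move=> /znneg_ge0; rewrite evN -(fev_res f g h x) => r fx gx hx.
have [] : [/\ 0 <= ev (fdet g h) * fev f x, 0 <= ev (fdet h f) * fev g x &
    0 <= ev (fdet f g) * fev h x] by split; apply: mulr_ge0 => //; apply: ltW.
move: abc => /orP[/orP[]|] /zpos_gt0 d.
- by have := mulr_gt0 d fx; lra.
- by have := mulr_gt0 d gx; lra.
- by have := mulr_gt0 d hx; lra.
Qed.

Lemma const_nonpos_sound f x : const_nonpos f -> 0 < fev f x -> False.
Proof.
case/and3P=> /zeqP f1 /zeqP f2 /znneg_ge0; rewrite evN /fev f1 f2 ev0; lra.
Qed.

Lemma has_sat (p : form -> bool) C x :
  has p C -> sat C x -> exists2 f, p f & 0 < fev f x.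
Proof.
elim: C => //= f C IH /orP[pf|/IH{}IH] /sat_cons[fx Cx]; first by exists f.
exact: IH.
Qed.

Lemma has_pairs_sat (r : form -> form -> bool) C x : has_pairs r C -> sat C x ->
  exists f g, [/\ r f g, 0 < fev f x & 0 < fev g x].
Proof.
elim: C => //= f C IH /orP[rf|/IH{}IH] /sat_cons[fx Cx]; last exact: IH.
by have [g rfg gx] := has_sat rf Cx; exists f, g.
Qed.

Lemma infeasible_sound C x : infeasible C -> sat C x -> False.
Proof.
case/orP=> [/has_sat H /H[f /const_nonpos_sound fP /fP //]|].
elim: C => //= f C IH /orP[H|/IH{}IH] /sat_cons[fx Cx]; last exact: IH.
have [g [h [/orP[] i gx hx]]] := has_pairs_sat H Cx.
- exact: infeasible3_sound i fx gx hx.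
- exact: infeasible3_sound i gx fx hx.
Qed.

Lemma entails2_sound f g h x :
  entails2 f g (fopp h) -> 0 < fev f x -> 0 < fev g x -> 0 < fev h x.
Proof.
move=> /and5P[/znneg_ge0 a /znneg_ge0 b /znneg_ge0 c abc].
move=> /znneg_ge0; rewrite evN -(fev_res f g _ x) fev_opp => r fx gx.
rewrite ltNge; apply/negP=> hx.
have [] : [/\ 0 <= ev (fdet g (fopp h)) * fev f x,
    0 <= ev (fdet (fopp h) f) * fev g x & 0 <= ev (fdet f g) * - fev h x].
  by split; apply: mulr_ge0 => //; rewrite ?oppr_ge0 // ltW.
move: abc => /orP[] /zpos_gt0 d.
- by have := mulr_gt0 d fx; lra.
- by have := mulr_gt0 d gx; lra.
Qed.

Lemma entails_sound C f x : entails C f -> sat C x -> 0 < fev f x.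
Proof.
case/orP=> [/and3P[/zeqP f1 /zeqP f2 /zpos_gt0 f3] _|H].
  by rewrite /fev f1 f2 ev0; lra.
move=> /(has_pairs_sat H)[g [h [/orP[] e gx hx]]].
- exact: entails2_sound e gx hx.
- exact: entails2_sound e hx gx.
Qed.

Lemma sat_prune D C x : sat (D ++ C) x -> sat (prune D C) x.
Proof.
elim: C D => [|f C IH] D /=; first by rewrite cats0.
rewrite !sat_cat sat_cons => -[Dx [fx Cx]]; case: ifP => _; apply: IH.
  by rewrite sat_cat.
rewrite -cats1 !sat_cat sat_cons; do !split=> //; exact: sat_nil.
Qed.

Implicit Types (S : system) (w : seq nat).

Section Lattice.
Variables (b : bool) (ls : seq form).

(** For the sides of the polygon, this is the complement of Y. *)
Definition off_lattice x : Prop := forall l (a : zphi),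
  List.In l ls -> in_lattice b a -> fev l x != ev (zadd a a).

Lemma lattice_formP f : lattice_form b ls f ->
  exists l u v a, [/\ List.In l ls, in_lattice b v, in_lattice b a,
    zmul u v = z1 & f = fscale u (fsub l (fconst (zadd a a)))].
Proof.
rewrite /lattice_form; elim: ls => //= l s IH /orP[|/IH].
  move=> /and4P[vb ab /zeqP uv /feqP ->].
  by do 4!eexists; split; [left; reflexivity|exact: vb|exact: ab|exact: uv|].
by move=> [l' [u [v [a [ll' *]]]]]; exists l', u, v, a; split=> //; right.
Qed.

Lemma off_lattice_neq0 f x :
  lattice_form b ls f -> off_lattice x -> fev f x != 0.
Proof.
move=> /lattice_formP[l [u [v [a [lls _ ab uv ->]]]]] /(_ l a lls ab) H.
rewrite fev_scale // fev_sub fev_const mulf_neq0 // ?subr_eq0 //.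
by apply/eqP=> u0; have := evM u v; rewrite uv u0 ev1; lra.
Qed.

Lemma off_lattice_map (g : aff) x :
  preserves_lattice b ls g -> off_lattice x -> off_lattice (aev g x).
Proof.
move=> gb xoff l c lls cb.
have := lattice_formP (all_In gb lls) => -[l' [u [v [a [l'ls vb ab uv e]]]]].
have uv1 : ev u * ev v = 1 by rewrite -(evM) uv ev1.
(* The pulled back form is [u (l' - 2 a)] with [u v = 1], so the value [2 c] would give [l'] the
   value [2 (a + v c)] at [x]. *)
apply: contra (xoff l' (zadd a (zmul v c)) l'ls _); last first.
  move: vb ab cb; rewrite /in_lattice; case: (b) => //=.
  by case: v {uv uv1} => ? ?; case: a {e} => ? ?; case: c => ? ? /=; nia.
rewrite -fev_pull // e fev_scale // fev_sub fev_const => /eqP H.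
apply/eqP; rewrite !(evD, evM) in H *.
have -> : fev l' x = ev v * (ev u * (fev l' x - (ev a + ev a))) + (ev a + ev a).
  by rewrite mulrA [ev v * _]mulrC uv1; ring.
by rewrite H; ring.
Qed.

(** All cuts follow lattice lines, so a point off the lattice is strictly on one side of each of
    them and is never lost. *)
Lemma covered_sound Ls C x : covered b ls Ls C -> off_lattice x -> sat C x ->
  exists2 L, List.In L Ls & sat L x.
Proof.
move=> + xoff; elim: Ls C => [|L Ls IH] C /=.
  by rewrite orbF => /infeasible_sound H /H.
move=> /orP[/infeasible_sound H /H //|]; case: ifP => _.
  by move=> /IH{}IH /IH[L' L'Ls xL']; exists L' => //; right.
move=> Hcut xC.
suff : sat L x \/ exists2 L, List.In L Ls & sat L x.
  case=> [xL|[L' L'Ls xL']]; first by exists L => //; left.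
  by exists L' => //; right.
move: C xC Hcut; elim: L => [|f L IHL] C xC.
  by move=> _; left; apply: sat_nil.
have cons0 : 0 < fev f x -> sat L x \/ (exists2 L, List.In L Ls & sat L x) ->
    sat (f :: L) x \/ (exists2 L, List.In L Ls & sat L x).
  by move=> fx [xL|]; [left; rewrite sat_cons|right].
case: ifP => [/entails_sound/(_ xC) fx /(IHL _ xC)|_]; first exact: cons0.
move=> /and3P[fb cC cL]; case: (ltgtP (fev f x) 0) => fx.
- right; apply: (IH _ cC); apply: (@sat_prune [::] (_ :: _)).
  by rewrite sat_cons fev_opp oppr_gt0.
- apply: cons0 => //; apply: (IHL _ _ cL).
  by apply: (@sat_prune [::] (_ :: _)); rewrite sat_cons.
- by move: (off_lattice_neq0 fb xoff); rewrite fx eqxx.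
Qed.

End Lattice.

Fixpoint follows S w x : Prop :=
  if w is a :: w' then
    sat (dom (piece_at S a)) x /\ follows S w' (aev (mv (piece_at S a)) x)
  else True.

Definition dest S w x : R * R :=
  foldl (fun x a => aev (mv (piece_at S a)) x) x w.

Lemma dest_cat S w w' x : dest S (w ++ w') x = dest S w' (dest S w x).
Proof. exact: foldl_cat. Qed.

Lemma follows_cat S w w' x :
  follows S (w ++ w') x <-> follows S w x /\ follows S w' (dest S w x).
Proof. by elim: w x => [|a w IH] x /=; [tauto|rewrite IH; tauto]. Qed.

Lemma end_map_dest S (h : aff) w x : aev (end_map S h w) x = dest S w (aev h x).
Proof.
elim: w h => [|a w IH] h //=.
by rewrite [end_map _ _ _]/= IH aev_comp.
Qed.

Lemma itinerary_sound S C (h : aff) w x :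
  itinerary_ok S C h w -> sat C x -> follows S w (aev h x).
Proof.
rewrite /itinerary_ok => H xC.
have {H xC} : sat (itinerary_forms S h w) x.
  by apply: sat_all H => f /entails_sound; apply.
elim: w h => //= a w IH h; rewrite sat_cat sat_pull // => -[xa /IH].
by rewrite aev_comp.
Qed.

Lemma sat_piece_lt S a x : sat (dom (piece_at S a)) x -> (a < size S)%N.
Proof.
rewrite /piece_at; case: (leqP (size S) a) => // ?.
by rewrite nth_default //= => /sat_cons[]; rewrite fev_const ev0 ltxx.
Qed.

Lemma disjoint_piecesP S a c x : disjoint_pieces S ->
  sat (dom (piece_at S a)) x -> sat (dom (piece_at S c)) x -> a = c.
Proof.
move=> /allP H xa xc.
have := H a; rewrite mem_iota (sat_piece_lt xa) => /(_ isT)/allP/(_ c).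
rewrite mem_iota (sat_piece_lt xc) => /(_ isT)/orP[/eqP //|].
by move=> /infeasible_sound H'; case: (H' x); rewrite sat_cat.
Qed.

Lemma follows_inj S w w' x : disjoint_pieces S -> size w = size w' ->
  follows S w x -> follows S w' x -> w = w'.
Proof.
move=> dS; elim: w w' x => [|a w IH] [|c w'] x //= [e] [xa xw] [xc xw'].
have ac := disjoint_piecesP dS xa xc; rewrite -ac in xw' *.
by rewrite (IH _ _ e xw xw').
Qed.

Lemma island_sound S n z x k : island_ok S n z ->
  sat (island S n z) x -> follows S (wpow z k) x.
Proof.
move=> /andP[H1 H2]; elim: k x => //= k IH x xI.
rewrite /wpow /= follows_cat; split.
  by rewrite -[x](aev_id); apply: itinerary_sound H1 xI.
apply: IH; rewrite -{1}[x](aev_id)-end_map_dest.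
rewrite -sat_pull //; apply: sat_all H2 => f /entails_sound; exact.
Qed.

Section Tower.
Variables (S S' : system) (Phi : aff) (psi : seq (seq nat)).

Lemma embeds_follows w x : embeds S S' Phi psi -> follows S w x ->
  follows S' (subst psi w) (aev Phi x) /\
  dest S' (subst psi w) (aev Phi x) = aev Phi (dest S w x).
Proof.
move=> /allP H; elim: w x => //= a w IH x [xa /IH[{}IH IHd]].
have : (a < size S)%N := sat_piece_lt xa.
have := H a; rewrite mem_iota /= add0n => /[apply] /andP[it /aeqP e].
have d : dest S' (letter_image psi a) (aev Phi x) =
    aev Phi (aev (mv (piece_at S a)) x).
  by rewrite -end_map_dest e aev_comp.
rewrite /subst /= -/(subst psi w) follows_cat dest_cat d IHd; do !split=> //.
exact: itinerary_sound it xa.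
Qed.

Lemma all_floorsP p a r : all_floors S psi p -> (a < size S)%N ->
  (r < size (letter_image psi a))%N -> p a r.
Proof.
move=> /allP H aS rs; have := H a; rewrite mem_iota => /(_ aS)/allP; apply.
by rewrite mem_iota.
Qed.

Lemma in_flatten_map (T : Type) (f : nat -> seq T) (y : T) (s : seq nat) :
  List.In y (flatten [seq f a | a <- s]) -> exists2 a, a \in s & List.In y (f a).
Proof.
elim: s => //= a s IH yas; case: (In_cat yas) => [ya|/IH[c cs yc]].
  by exists a => //; rewrite mem_head.
by exists c => //; rewrite inE cs orbT.
Qed.

Lemma in_map (I : eqType) (T : Type) (f : I -> T) (y : T) (s : seq I) :
  List.In y [seq f a | a <- s] -> exists2 a, a \in s & y = f a.
Proof.
elim: s => //= a s IH [<-|/IH[c cs ->]]; first by exists a => //; rewrite mem_head.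
by exists c => //; rewrite inE cs orbT.
Qed.

Lemma floorsP L : List.In L (floors S S' Phi psi) -> exists a r,
  [/\ (a < size S)%N, (r < size (letter_image psi a))%N &
      L = floor_ S S' Phi psi a r].
Proof.
move=> LF; have [a aS {}LF] := in_flatten_map LF.
have [r rs ->] := in_map LF; exists a, r.
by rewrite !mem_iota in aS rs.
Qed.

Lemma tower_floor b ls a r x : tower S S' Phi psi b ls ->
  (a < size S)%N -> (r < size (letter_image psi a))%N ->
  off_lattice b ls x -> sat (floor_ S S' Phi psi a r) x ->
  exists y, [/\ y = aev (floor_map S' Phi psi a r) x, off_lattice b ls y,
    sat (dom (piece_at S a)) y &
    x = dest S' (take r (letter_image psi a)) (aev Phi y)].
Proof.
move=> /andP[_ H] aS rs xoff xL; have /and3P[/aeqP e pl en] := all_floorsP H aS rs.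
exists (aev (floor_map S' Phi psi a r) x); split=> //.
- exact: off_lattice_map.
- by rewrite -sat_pull; apply: sat_all en => f /entails_sound; apply.
- by rewrite -end_map_dest -aev_comp e aev_id.
Qed.

Lemma tower_decreasesP m delta a r x : tower_decreases S S' Phi psi m delta ->
  (a < size S)%N -> (r < size (letter_image psi a))%N ->
  sat (floor_ S S' Phi psi a r) x ->
  fev m (aev (floor_map S' Phi psi a r) x) + ev delta < fev m x.
Proof.
move=> H aS rs /(entails_sound (all_floorsP H aS rs)).
by rewrite !fev_sub fev_const fev_pull; lra.
Qed.

End Tower.

End Semantics.

(** * The folded maps and their renormalisations *)

Definition zint (m n : int) : zphi := (Z_of_int m, Z_of_int n).

Definition form_p := Form z1 z0 z0.
Definition form_q := Form z0 z1 z0.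

Section FoldedSystem.
Variables (k : nat) (tau : zphi) (d : seq zphi).

(* The linear part of the signed distance to the line through [A_i, A_(i+1)]
   is [side_linear i.+1], in the coordinates where [A_0 = 0] and where the two
   sides at [A_0] are on the lines [p = 0] and [q = 0]. *)
Fixpoint side_linear2 (i : nat) : form * form :=
  if i is i'.+1 then
    let: (f, g) := side_linear2 i' in (g, fsub (fscale tau g) f)
  else (fopp form_p, form_q).

Definition side_linear i : form := (side_linear2 i).1.

(* [d`_j] is the signed distance from [A_j] to the line through [A_0, A_1]. *)
Definition side_offset (j : nat) : zphi := nth z0 d (j %% k).

Definition side i : form :=
  fsub (side_linear i.+1) (fconst (zopp (side_offset (k - i)))).

Definition sides : seq form := [seq side i | i <- iota 0 k].

(** The reflection about A_0 followed by [i] rotations: the new coordinates are minus the distance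
    from the reflected point to side [i - 1], and its distance to side [i]. *)
Definition folded_branch i : aff :=
  (fsub (side_linear i) (fconst (side_offset (k.+1 - i))),
   fsub (fconst (side_offset (k - i))) (side_linear i.+1)).

(** Apart from Y, the reflected point is in the cone V_i exactly when both coordinates of its
    rotated image are positive. *)
Definition folded : system :=
  [seq Piece [:: form_p; form_q; (folded_branch i).1; (folded_branch i).2]
         (folded_branch i) | i <- iota 0 k].

End FoldedSystem.

(* The points that follow [w ++ v], moved along [w]. *)
Definition induced (S : system) (w v : seq nat) : piece :=
  Piece (prune [::] (itinerary_forms S aid (w ++ v))) (end_map S aid w).

Definition translation (a b : zphi) : aff :=
  (fsub form_p (fconst (zopp a)), fsub form_q (fconst (zopp b))).

Definition islands (S : system) (n : nat) (z : seq nat) : seq (seq form) :=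
  [seq island S n (seq.rot i z) | i <- iota 0 (size z)].

Definition islands_ok S n z : bool :=
  all (fun i => island_ok S n (seq.rot i z)) (iota 0 (size z)).

Definition covers b ls (Ls : seq (seq form)) (S : system) : bool :=
  all (fun P => covered b ls Ls (dom P)) S.

(** The form [p + q], a height that decreases from each floor to its base. *)
Definition form_pq := fsub form_p (fopp form_q).

(* In the systems [tri_G], [sq_G], [hex_G], [pen_G] and [pen_D] the letters are
   numbered from 0; the lists [tri_code], ... spell them in the letters of the
   folded map. *)
Definition tri_d := [:: zint 0 0; zint 0 0; zint 1 0].
Definition tri := folded 3 (zint (-1) 0) tri_d.
Definition tri_sides := sides 3 (zint (-1) 0) tri_d.
Definition tri_G : system :=
  [:: induced tri [:: 1] [:: 1]; induced tri [:: 1; 2] [::]]%N.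
Definition tri_code : seq (seq nat) := [:: [:: 1]; [:: 1; 2]]%N.
Definition tri_Psi := translation (zint 2 0) (zint 2 0).
Definition tri_psi : seq (seq nat) := [:: [:: 1; 0]; [:: 1]]%N.

Definition sq_d := [:: zint 0 0; zint 0 0; zint 1 0; zint 1 0].
Definition sq := folded 4 (zint 0 0) sq_d.
Definition sq_sides := sides 4 (zint 0 0) sq_d.
Definition sq_G : system := [:: induced sq [:: 1] [::]; induced sq [:: 2] [::]]%N.
Definition sq_code : seq (seq nat) := [:: [:: 1]; [:: 2]]%N.
Definition sq_Psi := translation (zint 1 0) (zint 0 0).
Definition sq_psi : seq (seq nat) := [:: [:: 1; 0]; [:: 1]]%N.

Definition hex_d := [:: zint 0 0; zint 0 0; zint 1 0; zint 2 0; zint 2 0; zint 1 0].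
Definition hex := folded 6 (zint 1 0) hex_d.
Definition hex_sides := sides 6 (zint 1 0) hex_d.
Definition hex_G : system := [seq induced hex [:: i] [::] | i <- [:: 1; 2; 3]]%N.
Definition hex_code : seq (seq nat) := [:: [:: 1]; [:: 2]; [:: 3]]%N.
Definition hex_Psi := translation (zint 2 0) (zint 0 0).
Definition hex_psi : seq (seq nat) :=
  [:: [:: 2; 1; 1]; [:: 2; 1]; [:: 2]]%N.

Definition pen_d := [:: zint 0 0; zint 0 0; zint 1 0; zint 0 1; zint 1 0].
Definition pen_tau := zint (-1) 1.
Definition pen := folded 5 pen_tau pen_d.
Definition pen_sides := sides 5 pen_tau pen_d.

(* Letter 3 is always preceded by 2; the block 23 is the third letter of
   [pen_G], whose second letter is a 2 that is not followed by 3. *)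
Definition pen_G : system :=
  [:: induced pen [:: 1] [::];
      let P := induced pen [:: 2] [::] in
      Piece (fopp (pull (mv P) (mv (piece_at pen 3)).1) :: dom P) (mv P);
      induced pen [:: 2; 3] [::]]%N.
Definition pen_code : seq (seq nat) := [:: [:: 1]; [:: 2]; [:: 2; 3]]%N.
Definition pen_Psi := translation (zint 0 2) (zint 0 2).
Definition pen_psi : seq (seq nat) :=
  [:: [:: 2; 1; 1; 2; 1]; [:: 2; 1]; [:: 2]]%N.

(* The invariant neighbourhood of [A_0] on which only the letters 1 and 2 occur;
   [pen_Sigma] is a similarity of ratio [phi ^- 3]. *)
Definition pen_D : system :=
  [:: induced pen [:: 1] [::]; induced pen [:: 2] [:: 1]]%N.
Definition pen_Sigma : aff :=
  (fscale (zint (-3) 2) form_q, fscale (zint (-3) 2) form_p).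
Definition pen_sigma : seq (seq nat) :=
  [:: [:: 0; 0; 1; 0; 1; 0; 0]; [:: 0; 0; 0]]%N.
(** The central symmetry about the point [(phi, phi)], which carries D to its copy. *)
Definition pen_Xi : aff :=
  (fsub (fconst (zint 0 2)) form_p, fsub (fconst (zint 0 2)) form_q).
Definition pen_xi : seq (seq nat) := [:: [:: 1; 2; 1; 1]; [:: 1]]%N.
Definition pen_inc : seq (seq nat) := [:: [:: 0]; [:: 1]]%N.

(** * Factors of periodic words *)

(** The finitary form of [periodic_factors], with powers in place of infinite words; the two agree
    when no word of [Z] is empty. *)
Definition periodic_factor (A : Type) (Z : set (seq A)) : set (seq A) :=
  [set w | exists z n u v, Z z /\ wpow z n = u ++ w ++ v].

Section Words.
Context {A : Type}.
Implicit Types (u v w z : seq A) (Z : set (seq A)).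

Lemma wpowS z n : wpow z n.+1 = z ++ wpow z n.
Proof. by []. Qed.

Lemma wpow_rot u v n : u ++ wpow (v ++ u) n = wpow (u ++ v) n ++ u.
Proof. by elim: n => [|n IH]; rewrite ?cats0 // !wpowS -!catA IH. Qed.

Lemma wpowSr z n : wpow z n.+1 = wpow z n ++ z.
Proof. by have := wpow_rot z [::] n; rewrite cats0 /= -wpowS. Qed.

Lemma size_wpow z n : size (wpow z n) = (n * size z)%N.
Proof. by elim: n => // n IH; rewrite wpowS size_cat IH. Qed.

Lemma periodic_factor_sub Z u w v :
  periodic_factor Z (u ++ w ++ v) -> periodic_factor Z w.
Proof.
move=> [z [n [u' [v' [zZ e]]]]]; exists z, n, (u' ++ u), (v ++ v').
by split=> //; rewrite e -!catA.
Qed.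

Lemma periodic_factor_drop Z w n :
  periodic_factor Z w -> periodic_factor Z (drop n w).
Proof.
rewrite -{1}(cat_take_drop n w) -[drop n w in X in X -> _]cats0.
exact: periodic_factor_sub.
Qed.

Lemma periodic_factor_take Z w n :
  periodic_factor Z w -> periodic_factor Z (take n w).
Proof.
by rewrite -{1}(cat_take_drop n w) => /(@periodic_factor_sub Z [::]).
Qed.

Lemma periodic_factor_rot Z z i n :
  Z z -> periodic_factor Z (wpow (seq.rot i z) n).
Proof.
move=> zZ; exists z, n.+1, (take i z), (drop i z); split=> //.
by rewrite catA [take i z ++ _]wpow_rot -catA cat_take_drop wpowSr.
Qed.

End Words.

Section Subst.
Variable psi : seq (seq nat).
Implicit Types (u v w z : seq nat) (Z : set (seq nat)).

Lemma subst_cons a w : subst psi (a :: w) = letter_image psi a ++ subst psi w.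
Proof. by []. Qed.

Lemma subst_cat u v : subst psi (u ++ v) = subst psi u ++ subst psi v.
Proof. by rewrite /subst map_cat flatten_cat. Qed.

Lemma subst_wpow z n : subst psi (wpow z n) = wpow (subst psi z) n.
Proof. by elim: n => // n IH; rewrite !wpowS subst_cat IH. Qed.

Lemma periodic_factor_subst Z Z' w : (forall z, Z z -> Z' (subst psi z)) ->
  periodic_factor Z w -> periodic_factor Z' (subst psi w).
Proof.
move=> ZZ' [z [n [u [v [zZ e]]]]].
exists (subst psi z), n, (subst psi u), (subst psi v); split; first exact: ZZ'.
by rewrite -subst_wpow e !subst_cat.
Qed.

Lemma size_subst c w : all (fun a => c <= size (letter_image psi a))%N w ->
  (c * size w <= size (subst psi w))%N.
Proof.
elim: w => [|a w IH] /=; first by rewrite muln0.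
by move=> /andP[ca /IH]; rewrite subst_cons size_cat mulnS => /(leq_add ca).
Qed.

End Subst.

(** * Languages of renormalisable systems *)

Section Languages.
Variables (R : realType) (phi : R).
Hypotheses (phi_gt0 : 0 < phi) (phi_sqr : phi ^+ 2 = phi + 1).
Variables (b : bool) (ls : seq form).
Implicit Types (x y : R * R) (S : system) (w z : seq nat) (Z : set (seq nat)).

Local Notation fev := (fev phi).
Local Notation aev := (aev phi).
Local Notation sat := (sat phi).
Local Notation off := (off_lattice phi b ls).

Lemma follows_take S w x n : follows phi S w x -> follows phi S (take n w) x.
Proof. by rewrite -{1}(cat_take_drop n w) follows_cat => -[]. Qed.

Lemma follows_size_subst S psi c w x :
  all (fun a => c <= size (letter_image psi a))%N (iota 0 (size S)) ->
  follows phi S w x -> (c * size w <= size (subst psi w))%N.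
Proof.
move=> /allP H xw; apply: size_subst; elim: w x xw => //= a w IH x [xa /IH ->].
rewrite andbT; apply: H; rewrite mem_iota; exact: sat_piece_lt xa.
Qed.

Definition admits S Z (N : nat) x : Prop :=
  exists w, [/\ size w = N, periodic_factor Z w & follows phi S w x].

Lemma admits_leq S Z M N x : (M <= N)%N -> admits S Z N x -> admits S Z M x.
Proof.
move=> MN [w [wN Zw xw]]; exists (take M w); split.
- by rewrite size_takel ?wN.
- exact: periodic_factor_take.
- exact: follows_take.
Qed.

Lemma admits_island S n z Z N x L : Z z -> islands_ok S n z ->
  List.In L (islands S n z) -> sat L x -> admits S Z N x.
Proof.
move=> zZ /allP ok LI xL; have [i iz e] := in_map LI; subst L.
have z0 : (0 < size (seq.rot i z))%N.
  by move: iz; rewrite mem_iota size_rot; case: (size z).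
exists (take N (wpow (seq.rot i z) N)); split.
- by rewrite size_takel // size_wpow leq_pmulr.
- by apply: periodic_factor_take; apply: periodic_factor_rot.
- by apply: follows_take; apply: island_sound xL => //; apply: ok.
Qed.

(* A word read from the image of [y] under [Phi] loses at most its first block
   when it is read [r] steps later. *)
Lemma admits_floor S S' Phi psi Z Z' a r y c M N :
  embeds S S' Phi psi -> disjoint_pieces S ->
  all (fun a => c <= size (letter_image psi a))%N (iota 0 (size S)) ->
  (forall z, Z z -> Z' (subst psi z)) ->
  (r < size (letter_image psi a))%N -> sat (dom (piece_at S a)) y ->
  (N <= 1 + c * M)%N -> admits S Z M.+1 y ->
  admits S' Z' N (dest phi S' (take r (letter_image psi a)) (aev Phi y)).
Proof.
move=> emb dS cS ZZ' ra ya NM [[|a' w] [// [wM] Zw yw]].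
have e : a' = a by case: yw => ya' _; apply: disjoint_piecesP dS ya' ya.
subst a'; have [+ _] := embeds_follows phi_gt0 phi_sqr emb yw.
rewrite subst_cons -{1}(cat_take_drop r (letter_image psi a)) -catA follows_cat.
(* As [r] is smaller than the length of the first block, at least one letter of it remains; each of
   the [M] other letters gives at least [c]. *)
move=> [_ fl]; apply: (@admits_leq _ _ N (size (drop r (letter_image psi a) ++ subst psi w))).
  rewrite size_cat; apply: leq_trans NM _; apply: leq_add.
    by rewrite size_drop subn_gt0.
  by rewrite -wM; case: yw => _; apply: follows_size_subst.
exists (drop r (letter_image psi a) ++ subst psi w); split=> //.
have := periodic_factor_subst ZZ' Zw.
rewrite subst_cons -{1}(cat_take_drop r (letter_image psi a)) -catA.
by move/(periodic_factor_drop (size (take r (letter_image psi a)))); rewrite drop_size_cat.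
Qed.

Definition renormalises S S' Phi psi : bool :=
  [&& tower S S' Phi psi b ls, disjoint_pieces S &
      all (fun a => 1 <= size (letter_image psi a))%N (iota 0 (size S))].

Definition in_system S y : Prop := exists a, sat (dom (piece_at S a)) y.

Lemma admits_tower S S' Phi psi Z Z' x L N :
  renormalises S S' Phi psi -> (forall z, Z z -> Z' (subst psi z)) ->
  (forall y M, off y -> in_system S y -> admits S Z M y) ->
  off x -> List.In L (floors S S' Phi psi) -> sat L x -> admits S' Z' N x.
Proof.
move=> /and3P[T dS psi1] ZZ' IH xoff LF xL.
have [a [r [aS rs e]]] := floorsP LF; subst L.
have [y [_ yoff ya ->]] := tower_floor phi_gt0 phi_sqr T aS rs xoff xL.
have [emb _] := andP T.
apply: (@admits_floor S S' Phi psi Z Z' a r y 1 N) => //.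
- by rewrite mul1n add1n.
- by apply: IH => //; exists a.
Qed.

Lemma covers_sound Ls S x : covers b ls Ls S -> off x -> in_system S x ->
  exists2 L, List.In L Ls & sat L x.
Proof.
move=> H xoff [a xa]; have aS := sat_piece_lt xa.
have : covered b ls Ls (dom (piece_at S a)).
  exact: (all_nthP (Piece [:: fconst z0] aid) H).
by move=> /covered_sound; apply.
Qed.

Definition decreases S Phi psi m delta : bool :=
  [&& tower_decreases S S Phi psi m delta, zpos delta &
      all (fun a => entails (dom (piece_at S a)) m) (iota 0 (size S))].

(* The map [Phi] pushes the points away from the polygon, so that taking
   preimages repeatedly reaches the regions of [Ls]. *)
Lemma admits_renormalisable S Phi psi Z Ls m delta x N :
  renormalises S S Phi psi -> decreases S Phi psi m delta ->
  covers b ls (Ls ++ floors S S Phi psi) S ->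
  (forall z, Z z -> Z (subst psi z)) ->
  (forall L y M, List.In L Ls -> off y -> sat L y -> admits S Z M y) ->
  off x -> in_system S x -> admits S Z N x.
Proof.
move=> /and3P[T dS psi1] /and3P[dec /(zpos_gt0 phi_gt0 phi_sqr) d0 /allP m0] cov ZZ HL.
have [emb _] := andP T.
have [n] : exists n, fev m x < ev phi delta * n%:R.
  exists (Num.bound `|fev m x / ev phi delta|); rewrite mulrC -ltr_pdivrMr //.
  exact: le_lt_trans (ler_norm _) (archi_boundP (normr_ge0 _)).
elim: n x N => [|n IH] x N mx xoff xS.
  (* No descent is left, yet [m] is positive on every piece. *)
  have [a xa] := xS; have := m0 a; rewrite mem_iota (sat_piece_lt xa) => /(_ isT).
  by move/entails_sound => /(_ _ _ phi_gt0 phi_sqr _ xa); rewrite mulr0 in mx; lra.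
have [L LL xL] := covers_sound cov xoff xS; case: (In_cat LL) => [LLs|LF].
  exact: HL xL.
have [a [r [aS rs e]]] := floorsP LF; subst L.
have [y [ey yoff ya ex]] := tower_floor phi_gt0 phi_sqr T aS rs xoff xL.
have := tower_decreasesP phi_gt0 phi_sqr dec aS rs xL; rewrite -ey => my.
rewrite ex; apply: (@admits_floor S S Phi psi Z Z a r y 1 N) => //.
- by rewrite mul1n add1n.
- apply: IH => //; last by exists a.
  by rewrite -natr1 mulrDr mulr1 in mx; lra.
Qed.

(* Every letter is replaced by at least three letters, so that words longer than
   2 come from strictly shorter ones. *)
Lemma admits_contracted S Phi psi Z Ls Bs x N :
  renormalises S S Phi psi ->
  all (fun a => 3 <= size (letter_image psi a))%N (iota 0 (size S)) ->
  covers b ls (Ls ++ floors S S Phi psi) S ->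
  covers b ls Bs S ->
  (forall z, Z z -> Z (subst psi z)) ->
  (forall L y M, List.In L Ls -> off y -> sat L y -> admits S Z M y) ->
  (forall L y, List.In L Bs -> sat L y -> admits S Z 2 y) ->
  off x -> in_system S x -> admits S Z N x.
Proof.
move=> /and3P[T dS psi1] psi3 cov cov2 ZZ HL HB.
have [emb _] := andP T.
elim: N x => [|N IH] x xoff xS; last case: (leqP N 1) => N1.
- by have [L LB xL] := covers_sound cov2 xoff xS; apply: admits_leq (HB _ _ LB xL).
- by have [L LB xL] := covers_sound cov2 xoff xS; apply: admits_leq (HB _ _ LB xL).
have [L LL xL] := covers_sound cov xoff xS; case: (In_cat LL) => [LLs|LF].
  exact: HL xL.
have [a [r [aS rs e]]] := floorsP LF; subst L.
have [y [_ yoff ya ->]] := tower_floor phi_gt0 phi_sqr T aS rs xoff xL.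
(* From [N] letters at [y] one gets [1 + 3 (N - 1)] letters at [x], which is at least [N + 1]
   because [N >= 2]. *)
apply: (@admits_floor S S Phi psi Z Z a r y 3 N.-1) => //.
- by lia.
- by rewrite prednK ?(ltnW N1) //; apply: IH => //; exists a.
Qed.

(** * Periodic points *)

Definition periodic_at S z x : Prop := off x /\ forall n, follows phi S (wpow z n) x.

Lemma periodic_embeds S S' Phi psi z x : embeds S S' Phi psi ->
  preserves_lattice b ls Phi -> periodic_at S z x ->
  periodic_at S' (subst psi z) (aev Phi x).
Proof.
move=> emb pl [xoff xz]; split; first exact: off_lattice_map.
by move=> n; have [] := embeds_follows phi_gt0 phi_sqr emb (xz n); rewrite subst_wpow.
Qed.

End Languages.

(** * Points that avoid countably many lines *)

Lemma interval_avoids_countable (R : realType) (I : countType) (g : I -> R) (e : R) :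
  0 < e -> exists s, [/\ 0 < s, s < e & forall i, s != g i].
Proof.
move=> e0; apply: contrapT => H.
have sub : `]0, e[ `<=` range g.
  move=> s /=; rewrite in_itv /= => /andP[s0 se]; apply: contrapT => ns.
  by apply: H; exists s; split=> // i; apply/eqP => sg; apply: ns; exists i.
have cnt : countable `]0, e[.
  apply: sub_countable (countableP (@setT I)).
  by apply: card_le_trans (card_image_le g setT); apply: subset_card_le.
(* A countable set is Lebesgue-null, whereas the interval has measure [e]. *)
have := countable_lebesgue_measure0 cnt.
rewrite lebesgue_measure_itv /= lte_fin e0 oppr0 adde0 => /eqP.
by rewrite eqe (gt_eqF e0).
Qed.

(* Witness that the polygon [C] contains the point [(a / n, c / n)]. *)
Definition inner_point (a c n : zphi) (C : seq form) : bool :=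
  zpos n && all (fun f =>
    zpos (zadd (zadd (zmul (fa f) a) (zmul (fb f) c)) (zmul (fc f) n))) C.

(* No line of the lattice has the direction (1, 2). *)
Definition transverse (ls : seq form) : bool :=
  all (fun l => let s := zadd (fa l) (zadd (fb l) (fb l)) in
                zpos s || zpos (zopp s)) ls.

Section OffLattice.
Variables (R : realType) (phi : R).
Hypotheses (phi_gt0 : 0 < phi) (phi_sqr : phi ^+ 2 = phi + 1).

Local Notation ev := (ev phi).
Local Notation fev := (fev phi).
Local Notation sat := (sat phi).

Let ray (x : R * R) (s : R) : R * R := (x.1 + s, x.2 + (s + s)).

Lemma sat_ray C x : sat C x ->
  exists2 e : R, 0 < e & forall s, 0 < s < e -> sat C (ray x s).
Proof.
elim: C => [|f C IH]; first by exists 1 => // s _; exact: sat_nil.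
move=> /sat_cons[fx /IH[e e0 He]].
pose m := ev (fa f) + (ev (fb f) + ev (fb f)).
have m0 : 0 < `|m| + 1 by rewrite ltr_pwDr.
exists (Num.min e (fev f x / (`|m| + 1))).
  by rewrite lt_min e0 divr_gt0.
move=> s /andP[s0]; rewrite lt_min ltr_pdivlMr // => /andP[se sf].
apply/sat_cons; split; last by apply: He; rewrite s0.
have -> : fev f (ray x s) = fev f x + s * m by rewrite /fev /ray /m /=; ring.
have := ler_norm (- m); rewrite normrN => mn.
have : s * (- m) <= s * `|m| by rewrite ler_pM2l.
by rewrite mulrDr mulr1 mulrN in sf *; lra.
Qed.

(** Start from the inner point and move along the direction (1, 2). Each lattice line is met for a
    single parameter [g i], and a small parameter avoids these countably many values while staying
    in the open polygon. *)
Lemma off_lattice_point b ls C a c n : transverse ls -> inner_point a c n C ->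
  exists x, off_lattice phi b ls x /\ sat C x.
Proof.
move=> tr /andP[/(zpos_gt0 phi_gt0 phi_sqr) n0 HC].
pose x0 := (ev a / ev n, ev c / ev n).
have /sat_ray[e e0 He] : sat C x0.
  apply: sat_all HC => f /(zpos_gt0 phi_gt0 phi_sqr).
  rewrite !(evD, evM phi_sqr) -(pmulr_lgt0 (fev f x0) n0) => H.
  suff -> : fev f x0 * ev n = ev (fa f) * ev a + ev (fb f) * ev c + ev (fc f) * ev n.
    by [].
  by rewrite /fev /x0 /=; field; rewrite gt_eqF.
pose l0 := fconst z0.
pose slope l := ev (fa l) + (ev (fb l) + ev (fb l)).
pose g (i : nat * (Z * Z)) : R :=
  let l := nth l0 ls i.1 in (ev (zadd i.2 i.2) - fev l x0) / slope l.
have [s [s0 se sg]] := interval_avoids_countable g e0.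
exists (ray x0 s); split; last by apply: He; rewrite s0.
move=> l d lls _; apply/eqP => ld.
have [i il] : exists i, nth l0 ls i = l.
  elim: (ls) lls => //= l' ls' IH [<-|/IH[i <-]]; first by exists 0%N.
  by exists i.+1.
have sl : slope l != 0.
  have := all_In tr lls => /orP[] /(zpos_gt0 phi_gt0 phi_sqr);
    by rewrite ?evN !evD -/(slope l); case: (slope l =P 0) => // ->; rewrite ?oppr0 ltxx.
have /eqP := sg (i, d); apply; rewrite /g /= il -ld.
have -> : fev l (ray x0 s) = fev l x0 + s * slope l.
  by rewrite /fev /ray /slope /=; ring.
by rewrite addrAC subrr add0r mulfK.
Qed.

End OffLattice.

(** * Languages of systems as sets of periodic factors *)

Definition orbit_words (psi : seq (seq nat)) (Z : set (seq nat)) : set (seq nat) :=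
  [set z | exists n z0, Z z0 /\ z = iter n (subst psi) z0].

Lemma orbit_words_subst psi Z z :
  orbit_words psi Z z -> orbit_words psi Z (subst psi z).
Proof. by move=> [n [z0 [Zz0 ->]]]; exists n.+1, z0. Qed.

Lemma sub_orbit_words psi Z z : Z z -> orbit_words psi Z z.
Proof. by exists 0%N, z. Qed.

Definition closed_system b ls (F : system) : bool :=
  disjoint_pieces F &&
  all (fun a => let P := piece_at F a in
    [&& preserves_lattice b ls (mv P), entails (dom P) form_p &
        entails (dom P) form_q]) (iota 0 (size F)).

Section SystemLanguage.
Variables (R : realType) (phi : R).
Hypotheses (phi_gt0 : 0 < phi) (phi_sqr : phi ^+ 2 = phi + 1).
Variables (b : bool) (ls : seq form).
Implicit Types (x y : R * R) (S F : system) (w z : seq nat) (Z : set (seq nat)).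

Local Notation sat := (sat phi).
Local Notation off := (off_lattice phi b ls).
Local Notation periodic_at := (periodic_at phi b ls).

Definition system_language F : set (seq nat) :=
  [set w | exists x, [/\ off x, 0 < x.1, 0 < x.2 & follows phi F w x]].

Lemma periodic_island S n z a c d : islands_ok S n z -> z != [::] ->
  transverse ls -> inner_point a c d (island S n z) -> exists x, periodic_at S z x.
Proof.
move=> /allP ok z0 tr /(off_lattice_point phi_gt0 phi_sqr b tr)[x [xoff xI]].
exists x; split=> // k; apply: island_sound (xI) => //.
by have := ok 0%N; rewrite rot0 mem_iota; apply; case: (z) z0.
Qed.

Lemma periodic_nonempty S S' psi z x :
  all (fun a => 1 <= size (letter_image psi a))%N (iota 0 (size S)) ->
  z != [::] -> periodic_at S z x -> subst psi z != [::].
Proof.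
move=> psi1 z0 [_ /(_ 1%N)]; rewrite /wpow /= cats0 => xz.
rewrite -size_eq0 -lt0n; apply: leq_trans (follows_size_subst psi1 xz).
by rewrite mul1n lt0n size_eq0.
Qed.

Lemma periodic_orbit S Phi psi Zb z : renormalises b ls S S Phi psi ->
  preserves_lattice b ls Phi ->
  (forall z, Zb z -> z != [::] /\ exists x, periodic_at S z x) ->
  orbit_words psi Zb z -> z != [::] /\ exists x, periodic_at S z x.
Proof.
move=> /and3P[T dS psi1] pl H [n [z0 [/H Hz0 ->]]]; elim: n => //= n [IH [x xz]].
have [emb _] := andP T; split; first exact: periodic_nonempty xz.
exists (aev phi Phi x); exact: (periodic_embeds phi_gt0 phi_sqr emb pl xz).
Qed.

Lemma off_dest F u x : closed_system b ls F -> off x -> follows phi F u x ->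
  off (dest phi F u x).
Proof.
move=> /andP[_ /allP H]; elim: u x => //= a u IH x xoff [xa xu].
apply: IH => //; apply: off_lattice_map => //.
by have := H a; rewrite mem_iota (sat_piece_lt xa) => /(_ isT)/and3P[].
Qed.

(** One inclusion holds because disjoint pieces make the itinerary of a given length unique; for the
    other, a factor of a periodic coding is read from an iterate of the periodic point. *)
Lemma system_languageE F Z : closed_system b ls F ->
  (forall x N, off x -> 0 < x.1 -> 0 < x.2 -> admits phi F Z N x) ->
  (forall z, Z z -> z != [::] /\ exists x, periodic_at F z x) ->
  system_language F = periodic_factor Z.
Proof.
move=> cF HZ perZ; have [dF /allP FF] := andP cF.
apply/seteqP; split=> w.
  move=> [x [xoff x1 x2 xw]]; have [w' [ww' Zw' xw']] := HZ x (size w) xoff x1 x2.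
  by rewrite (follows_inj phi_gt0 phi_sqr dF _ xw xw').
move=> [z [n [u [v [Zz e]]]]]; have [z0 [x [xoff xz]]] := perZ z Zz.
(* The extra period leaves a letter to read after [u] even when [w] and [v] are empty; it puts the
   iterate in some piece, hence in the open quadrant. *)
have := xz n.+1; rewrite wpowSr e -catA follows_cat => -[xu xw].
exists (dest phi F u x); have yoff := off_dest cF xoff xu.
have [x1 x2] : 0 < (dest phi F u x).1 /\ 0 < (dest phi F u x).2.
  case E: ((w ++ v) ++ z) xw => [|a s] /=; first by case: (w ++ v) z0 E; case: (z).
  move=> [xa _]; have := FF a; rewrite mem_iota (sat_piece_lt xa).
  move=> /(_ isT)/and3P[_ /entails_sound/(_ xa) + /entails_sound/(_ xa)].
  move=> /(_ phi_gt0 phi_sqr) + /(_ phi_gt0 phi_sqr).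
  by rewrite /fev /= ev0 ev1; lra.
split=> //.
by move: xw; rewrite -catA follows_cat => -[].
Qed.

(** The quadrant is covered by the floors over [G], and the points of [G] descend through [Phi] to
    the regions of [Ls]. Conversely, the periodic points of the words in [Zb] are transported by
    [Phi], then read in [F]. *)
Lemma renormalisable_language F G code Phi psi Zb Ls m delta :
  closed_system b ls F ->
  renormalises b ls G F aid code -> preserves_lattice b ls aid ->
  covered b ls (floors G F aid code) [:: form_p; form_q] ->
  renormalises b ls G G Phi psi -> preserves_lattice b ls Phi ->
  decreases G Phi psi m delta -> covers b ls (Ls ++ floors G G Phi psi) G ->
  (forall L y M, List.In L Ls -> off y -> sat L y ->
    admits phi G (orbit_words psi Zb) M y) ->
  (forall z, Zb z -> z != [::] /\ exists x, periodic_at G z x) ->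
  system_language F = periodic_factor (subst code @` orbit_words psi Zb).
Proof.
move=> cF rF pid covF rG pPhi dec cov HL perb; apply: system_languageE => //.
- move=> x N xoff x1 x2.
  have [|L LF xL] := covered_sound phi_gt0 phi_sqr covF xoff.
    by move=> f /= [<-|[<-|//]]; rewrite /fev /= ev0 ev1; lra.
  have ZZ z : orbit_words psi Zb z -> (subst code @` orbit_words psi Zb) (subst code z).
    by move=> Zz; exists z.
  apply: (admits_tower phi_gt0 phi_sqr N rF ZZ _ xoff LF xL) => y M yoff yG.
  apply: (admits_renormalisable phi_gt0 phi_sqr M rG dec cov _ HL yoff yG) => z.
  exact: orbit_words_subst.
- move=> _ [z Zz <-]; have [z0 [x xz]] := periodic_orbit rG pPhi perb Zz.
  have /and3P[/andP[emb _] _ code1] := rF.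
  split; first exact: (periodic_nonempty F code1 z0 xz).
  exists (aev phi aid x); exact: (periodic_embeds phi_gt0 phi_sqr emb pid xz).
Qed.

End SystemLanguage.

Ltac vm_check := lazymatch goal with |- is_true _ => vm_compute; reflexivity end.

(** * Languages of the four folded systems, by computation *)

Section FourLanguages.
Variables (R : realType) (phi : R).
Hypotheses (phi_gt0 : 0 < phi) (phi_sqr : phi ^+ 2 = phi + 1).

Lemma tri_language : system_language phi false tri_sides tri =
  periodic_factor (subst tri_code @`
    orbit_words tri_psi [set [:: 0]; [:: 0; 1; 0]]%N).
Proof.
apply: (@renormalisable_language _ _ phi_gt0 phi_sqr _ _ tri tri_G tri_code
  tri_Psi tri_psi _ (islands tri_G 6 [:: 0]%N ++ islands tri_G 3 [:: 0; 1; 0]%N)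
  form_pq (zint 1 0)); try vm_check.
- move=> L y M LI _ yL; case: (In_cat LI) => {}LI.
  + apply: (admits_island phi_gt0 phi_sqr M _ _ LI yL); last vm_check.
    by apply: sub_orbit_words; left.
  + apply: (admits_island phi_gt0 phi_sqr M _ _ LI yL); last vm_check.
    by apply: sub_orbit_words; right.
- move=> z [] ->; split=> //.
  (* The last three arguments give an inner point of the island by numerators and common
     denominator: [(1, 1)] here, [(5/3, 7/3)] for the other word. *)
  + apply: (@periodic_island _ _ phi_gt0 phi_sqr _ _ _ 6 _
      (zint 1 0) (zint 1 0) (zint 1 0)); vm_check.
  + apply: (@periodic_island _ _ phi_gt0 phi_sqr _ _ _ 3 _
      (zint 5 0) (zint 7 0) (zint 3 0)); vm_check.
Qed.

Lemma sq_language : system_language phi false sq_sides sq =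
  periodic_factor (subst sq_code @` orbit_words sq_psi [set [:: 0]%N]).
Proof.
(* On the lowest floors [p + q] drops by exactly 1 and the inequality on drops is strict, so [delta]
   is [phi - 1], which lies between 0 and 1. *)
apply: (@renormalisable_language _ _ phi_gt0 phi_sqr _ _ sq sq_G sq_code
  sq_Psi sq_psi _ (islands sq_G 4 [:: 0]%N) form_pq (zint (-1) 1));
  try vm_check.
- move=> L y M LI _ yL; apply: (admits_island phi_gt0 phi_sqr M _ _ LI yL); last vm_check.
  exact: sub_orbit_words.
- move=> z ->; split=> //.
  apply: (@periodic_island _ _ phi_gt0 phi_sqr _ _ _ 4 _
    (zint 1 0) (zint 1 0) (zint 2 0)); vm_check.
Qed.

Lemma hex_language : system_language phi false hex_sides hex =
  periodic_factor (subst hex_code @` orbit_words hex_psi [set [:: 0]; [:: 1]]%N).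
Proof.
apply: (@renormalisable_language _ _ phi_gt0 phi_sqr _ _ hex hex_G hex_code
  hex_Psi hex_psi _ (islands hex_G 6 [:: 0]%N ++ islands hex_G 6 [:: 1]%N)
  form_pq (zint (-1) 1)); try vm_check.
- move=> L y M LI _ yL; case: (In_cat LI) => {}LI.
  + apply: (admits_island phi_gt0 phi_sqr M _ _ LI yL); last vm_check.
    by apply: sub_orbit_words; left.
  + apply: (admits_island phi_gt0 phi_sqr M _ _ LI yL); last vm_check.
    by apply: sub_orbit_words; right.
- move=> z [] ->; split=> //.
  + apply: (@periodic_island _ _ phi_gt0 phi_sqr _ _ _ 6 _
      (zint 1 0) (zint 1 0) (zint 3 0)); vm_check.
  + apply: (@periodic_island _ _ phi_gt0 phi_sqr _ _ _ 6 _
      (zint 1 0) (zint 1 0) (zint 1 0)); vm_check.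
Qed.

Definition pen_ZD : set (seq nat) :=
  orbit_words pen_sigma [set [:: 0]; [:: 0; 1]]%N.

Let off := off_lattice phi true pen_sides.

Lemma pen_D_admits x N :
  off x -> in_system phi pen_D x -> admits phi pen_D pen_ZD N x.
Proof.
move=> xoff xD.
(* The points of D off the lattice begin with 00, 01 or 10, never with 11; all three words are
   factors of powers of 0 or 01. *)
apply: (@admits_contracted _ _ phi_gt0 phi_sqr true pen_sides pen_D pen_Sigma
  pen_sigma _ (islands pen_D 10 [:: 0]%N ++ islands pen_D 5 [:: 0; 1]%N)
  [seq dom (induced pen_D w [::]) | w <- [:: [:: 0; 0]; [:: 0; 1]; [:: 1; 0]]]%N);
  try vm_check.
- by move=> z; apply: orbit_words_subst.
- move=> L y M LI _ yL; case: (In_cat LI) => {}LI.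
  + apply: (admits_island phi_gt0 phi_sqr M _ _ LI yL); last vm_check.
    by apply: sub_orbit_words; left.
  + apply: (admits_island phi_gt0 phi_sqr M _ _ LI yL); last vm_check.
    by apply: sub_orbit_words; right.
- have Z0 : pen_ZD [:: 0]%N by apply: sub_orbit_words; left.
  have Z01 : pen_ZD [:: 0; 1]%N by apply: sub_orbit_words; right.
  move=> L y LB yL; have [w wB e] := in_map LB; subst L; exists w.
  have {yL} yw : follows phi pen_D w y.
    rewrite -(aev_id phi y); apply: (itinerary_sound phi_gt0 phi_sqr _ yL).
    by move: wB {LB yL}; rewrite !inE => /or3P[] /eqP ->; vm_check.
  move: wB; rewrite !inE => /or3P[] /eqP e; subst w; split=> //.
  + by exists [:: 0]%N, 2%N, [::], [::].
  + by exists [:: 0; 1]%N, 1%N, [::], [::].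
  + by exists [:: 0; 1]%N, 2%N, [:: 0]%N, [:: 1]%N.
- exact: xoff.
- exact: xD.
Qed.

Lemma pen_D_periodic z : pen_ZD z ->
  z != [::] /\ exists x, periodic_at phi true pen_sides pen_D z x.
Proof.
apply: (@periodic_orbit _ _ phi_gt0 phi_sqr _ _ _ pen_Sigma); try vm_check.
move=> {}z [] ->; split=> //.
- apply: (@periodic_island _ _ phi_gt0 phi_sqr _ _ _ 10 _
    (zint 2 (-1)) (zint 2 (-1)) (zint 1 0)); vm_check.
- apply: (@periodic_island _ _ phi_gt0 phi_sqr _ _ _ 5 _
    (zint (-4) 3) (zint (-6) 7) (zint 5 0)); vm_check.
Qed.

Definition pen_Z : set (seq nat) :=
  [set [:: 1]; [:: 1; 1; 2]]%N `|`
  (subst pen_inc @` pen_ZD `|` subst pen_xi @` pen_ZD).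

Lemma pen_language : system_language phi true pen_sides pen =
  periodic_factor (subst pen_code @` orbit_words pen_psi pen_Z).
Proof.
apply: (@renormalisable_language _ _ phi_gt0 phi_sqr _ _ pen pen_G pen_code
  pen_Psi pen_psi _ ((islands pen_G 10 [:: 1]%N ++ islands pen_G 5 [:: 1; 1; 2]%N)
    ++ floors pen_D pen_G aid pen_inc ++ floors pen_D pen_G pen_Xi pen_xi)
  form_pq (zint (-1) 1)); try vm_check.
(* Four kinds of regions: two cycles of islands, then the floors over D for the inclusion and for
   its copy by [pen_Xi]. *)
- move=> L y M LI yoff yL.
  case: (In_cat LI) => {}LI; case: (In_cat LI) => {}LI.
  + apply: (admits_island phi_gt0 phi_sqr M _ _ LI yL); last vm_check.
    by apply: sub_orbit_words; left; left.
  + apply: (admits_island phi_gt0 phi_sqr M _ _ LI yL); last vm_check.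
    by apply: sub_orbit_words; left; right.
  + apply: (@admits_tower _ _ phi_gt0 phi_sqr true pen_sides pen_D pen_G aid
      pen_inc pen_ZD _ y L M) => [|||//|//|//]; first vm_check.
      by move=> z Zz; apply: sub_orbit_words; right; left; exists z.
    by move=> x N; apply: pen_D_admits.
  + apply: (@admits_tower _ _ phi_gt0 phi_sqr true pen_sides pen_D pen_G pen_Xi
      pen_xi pen_ZD _ y L M) => [|||//|//|//]; first vm_check.
      by move=> z Zz; apply: sub_orbit_words; right; right; exists z.
    by move=> x N; apply: pen_D_admits.
- have image Phi psi z : embeds pen_D pen_G Phi psi ->
      preserves_lattice true pen_sides Phi ->
      all (fun a => 1 <= size (letter_image psi a))%N (iota 0 (size pen_D)) ->
      pen_ZD z -> subst psi z != [::] /\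
      exists x, periodic_at phi true pen_sides pen_G (subst psi z) x.
    move=> emb pl psi1 /pen_D_periodic[z0 [x xz]].
    split; first exact: (periodic_nonempty pen_G psi1 z0 xz).
    exists (aev phi Phi x); exact: (periodic_embeds phi_gt0 phi_sqr emb pl xz).
  move=> _ [[] ->|[[z Zz <-]|[z Zz <-]]].
  + split=> //; apply: (@periodic_island _ _ phi_gt0 phi_sqr _ _ _ 10 _
      (zint 0 1) (zint 0 1) (zint 1 0)); vm_check.
  + split=> //; apply: (@periodic_island _ _ phi_gt0 phi_sqr _ _ _ 5 _
      (zint 2 1) (zint 8 9) (zint 5 0)); vm_check.
  + apply: (image aid _ _ _ _ _ Zz); vm_check.
  + apply: (image pen_Xi _ _ _ _ _ Zz); vm_check.
Qed.

End FourLanguages.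

(** * Periodic factors and conjugate words *)

Section FactorSets.
Implicit Types A : pointedType.

Lemma nth_wpow (T : Type) (d : T) (z : seq T) n j : (j < n * size z)%N ->
  nth d (wpow z n) j = nth d z (j %% size z).
Proof.
elim: n j => // n IH j; rewrite wpowS nth_cat mulSn; case: (ltnP j (size z)) => [js _|sj H].
  by rewrite modn_small.
rewrite IH; last by rewrite ltn_subLR.
by rewrite -{2}(subnK sj) modnDr.
Qed.

Lemma periodic_factorsE A (Z : set (seq A)) :
  (forall z, Z z -> z <> [::]) -> periodic_factors Z = periodic_factor Z.
Proof.
move=> Z0; apply/seteqP; split=> w.
  move=> [z Zz [m wE]]; have s0 : (0 < size z)%N by case: z Zz {wE} => // /Z0.
  (* That many copies suffice, since each has at least one letter. *)
  pose n := (m + size w)%N; exists z, n.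
  exists (take m (wpow z n)), (drop (m + size w) (wpow z n)); split=> //.
  have sn : (m + size w <= size (wpow z n))%N by rewrite size_wpow leq_pmulr.
  have e : take (size w) (drop m (wpow z n)) = w.
    apply: (@eq_from_nth _ point).
      by rewrite size_takel // size_drop; lia.
    rewrite size_takel ?size_drop; last by lia.
    move=> i iw; rewrite nth_take // nth_drop nth_wpow; last first.
      by apply: leq_trans (leq_pmulr _ s0); rewrite ltn_add2l.
    by rewrite wE nth_mkseq.
  by rewrite addnC -drop_drop -{1}e !cat_take_drop.
move=> [z [n [u [v [Zz e]]]]]; exists z => //; exists (size u).
apply: (@eq_from_nth _ point); first by rewrite size_mkseq.
move=> i iw; rewrite nth_mkseq // /omega -(nth_wpow _ (n := n)).
  by rewrite e nth_cat ltnNge leq_addr /= addKn nth_cat iw.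
by rewrite -size_wpow e !size_cat ltn_add2l ltn_addr.
Qed.

Lemma periodic_factor_map A (T : Type) (f : T -> A) (Z : set (seq T)) :
  periodic_factor (map f @` Z) = map f @` periodic_factor Z.
Proof.
have wpow_map z n : wpow (map f z) n = map f (wpow z n).
  by elim: n => // n IH; rewrite !wpowS map_cat IH.
apply/seteqP; split=> w.
  move=> [_ [n [u [v [[z Zz <-] e]]]]]; rewrite wpow_map in e.
  exists (take (size w) (drop (size u) (wpow z n))).
    exists z, n, (take (size u) (wpow z n)), (drop (size w) (drop (size u) (wpow z n))).
    by rewrite !cat_take_drop.
  by rewrite map_take map_drop e drop_size_cat // take_size_cat.
move=> [w' [z [n [u [v [Zz e]]]]] <-].
exists (map f z), n, (map f u), (map f v); split; first by exists z.
by rewrite wpow_map e !map_cat.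
Qed.

End FactorSets.

Section Conjugate.
Context {A : Type}.
Implicit Types (u v w z : seq A) (Z : set (seq A)).

Definition conjugate z z' : Prop := exists u v, z = u ++ v /\ z' = v ++ u.

Lemma conjugate_refl z : conjugate z z.
Proof. by exists z, [::]; rewrite cats0. Qed.

Lemma conjugate_sym z z' : conjugate z z' -> conjugate z' z.
Proof. by move=> [u [v [-> ->]]]; exists v, u. Qed.

(** A power of a rotated word is a factor of a higher power of the word, so only the conjugacy
    classes of the periods matter. *)
Lemma sub_periodic_factor Z Z' :
  (forall z, Z z -> exists2 z', Z' z' & conjugate z z') ->
  periodic_factor Z `<=` periodic_factor Z'.
Proof.
move=> H w [z [n [u [v [/H[z' Zz' [a [c [e e']]]]] e1]]]].
suff : periodic_factor Z' (wpow z n) by rewrite e1; apply: periodic_factor_sub.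
have -> : z = seq.rot (size c) z' by rewrite e e' rot_size_cat.
exact: periodic_factor_rot.
Qed.

Lemma eq_periodic_factor Z Z' :
  (forall z, Z z -> exists2 z', Z' z' & conjugate z z') ->
  (forall z, Z' z -> exists2 z', Z z' & conjugate z z') ->
  periodic_factor Z = periodic_factor Z'.
Proof. by move=> H H'; apply/seteqP; split; apply: sub_periodic_factor. Qed.

End Conjugate.

Lemma conjugate_subst psi z z' :
  conjugate z z' -> conjugate (subst psi z) (subst psi z').
Proof.
move=> [u [v [-> ->]]]; exists (subst psi u), (subst psi v).
by rewrite !subst_cat.
Qed.

(** Letter by letter, [u f(w) = g(w) u]. Since [g(w)] begins with [u], moving this prefix to the end
    turns [g(w)] into [f(w)]. *)
Lemma conjugate_subst2 (f g : seq (seq nat)) (P : pred nat) u w :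
  (forall a, P a -> u ++ letter_image f a = letter_image g a ++ u) ->
  (forall a, P a -> exists s, letter_image g a = u ++ s) ->
  all P w -> conjugate (subst f w) (subst g w).
Proof.
move=> fg gu; case: w => [_|a w aw]; first exact: conjugate_refl.
have e : u ++ subst f (a :: w) = subst g (a :: w) ++ u.
  elim: (a :: w) aw => [|c w' IH] /=; first by rewrite cats0.
  by move=> /andP[Pc /IH{}IH]; rewrite !subst_cons catA fg // -!catA IH.
have /andP[/gu[s gs] _] := aw.
move: e; rewrite (subst_cons g) gs -!catA => /(congr1 (drop (size u))).
rewrite !drop_size_cat // => ->.
by exists (s ++ subst g w), u; rewrite -!catA.
Qed.

(** * The words of the regular triangle, square and hexagon *)

Lemma iter_subst_cat psi n u v :
  iter n (subst psi) (u ++ v) = iter n (subst psi) u ++ iter n (subst psi) v.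
Proof. by elim: n => //= n ->; rewrite subst_cat. Qed.

Lemma iter_subst_fixed psi n a : letter_image psi a = [:: a] ->
  iter n (subst psi) [:: a] = [:: a].
Proof. by move=> e; elim: n => //= n ->; rewrite /subst /= e. Qed.

Lemma iter_subst_prepend psi n a c : letter_image psi a = [:: c; a] ->
  letter_image psi c = [:: c] -> iter n (subst psi) [:: a] = rcons (nseq n c) a.
Proof.
move=> ea ec; elim: n => // n IH; rewrite iterSr {2}/subst /= ea /=.
by rewrite (iter_subst_cat psi n [:: c] [:: a]) IH iter_subst_fixed.
Qed.

Lemma subst_nseq psi n a : subst psi (nseq n a) = wpow (letter_image psi a) n.
Proof. by elim: n => //= n IH; rewrite subst_cons IH. Qed.

Lemma periodic_triangle :
  periodic_factor (subst tri_code @` orbit_words tri_psi [set [:: 0]; [:: 0; 1; 0]]%N) =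
  periodic_factors Z_triangle.
Proof.
rewrite periodic_factorsE; last by move=> z [n _ []] ->.
have it n : subst tri_code (iter n (subst tri_psi) [:: 0])%N =
    (1 :: wpow [:: 2; 1] n)%N.
  rewrite (@iter_subst_prepend _ _ _ 1%N) // -cats1 subst_cat subst_nseq /=.
  exact/esym/(wpow_rot [:: 1]%N [:: 2]%N).
have it2 n : subst tri_code (iter n (subst tri_psi) [:: 0; 1; 0])%N =
    (1 :: wpow [:: 2; 1] n)%N ++ (1 :: wpow [:: 2; 1] n.+1)%N.
  (* The remaining part 10 is the image of 0, which accounts for the exponent [n + 1]. *)
  rewrite (iter_subst_cat _ _ [:: 0] [:: 1; 0])%N subst_cat it; congr (_ ++ _).
  by rewrite -it iterSr.
congr periodic_factor; apply/seteqP; split=> z.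
  by move=> [_ [n [z0 [[] -> ->]] <-]]; exists n => //; [left|right].
move=> [n _ [] ->]; [rewrite -it|rewrite -it2]; eexists=> //.
  by exists n; eexists; split; [left|].
by exists n; eexists; split; [right|].
Qed.

Lemma periodic_square :
  periodic_factor (subst sq_code @` orbit_words sq_psi [set [:: 0]%N]) =
  periodic_factors Z_square.
Proof.
rewrite periodic_factorsE; last by move=> z [n _ ->].
have it n : conjugate (subst sq_code (iter n (subst sq_psi) [:: 0]))%N
    (1 :: wpow [:: 2] n)%N.
  rewrite (@iter_subst_prepend _ _ _ 1%N) // -cats1 subst_cat subst_nseq /=.
  by exists (wpow [:: 2]%N n), [:: 1]%N.
apply: eq_periodic_factor => z.
  by move=> [_ [n [z0 [-> ->]] <-]]; exists (1 :: wpow [:: 2] n)%N => //; exists n.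
move=> [n _ ->]; eexists; last exact/conjugate_sym/it.
by eexists=> //; exists n; eexists; split.
Qed.

Lemma periodic_hexagon :
  periodic_factor (subst hex_code @` orbit_words hex_psi [set [:: 0]; [:: 1]]%N) =
  periodic_factors Z_hexagon.
Proof.
rewrite periodic_factorsE; last by move=> z [[n _ []]|] ->.
have it n : subst hex_code (iter n (subst hex_psi) [:: 1])%N =
    wpow [:: 3]%N n ++ [:: 2]%N.
  by rewrite (@iter_subst_prepend _ _ _ 2%N) // -cats1 subst_cat subst_nseq.
have itc n : conjugate (subst hex_code (iter n (subst hex_psi) [:: 1]))%N
    (2 :: wpow [:: 3] n)%N.
  by rewrite it; exists (wpow [:: 3]%N n), [:: 2]%N.
have it2 n : conjugate (subst hex_code (iter n.+1 (subst hex_psi) [:: 0]))%N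
    ((2 :: wpow [:: 3] n)%N ++ (2 :: wpow [:: 3] n.+1)%N).
  (* The image 211 of the letter 0 is the image 21 of the letter 1, followed by 1. *)
  rewrite iterSr (iter_subst_cat _ _ [:: 2; 1] [:: 1])%N subst_cat it.
  have -> : iter n (subst hex_psi) [:: 2; 1]%N = iter n.+1 (subst hex_psi) [:: 1]%N.
    by rewrite iterSr.
  rewrite it; exists (wpow [:: 3]%N n.+1), ([:: 2]%N ++ wpow [:: 3]%N n ++ [:: 2]%N).
  by rewrite -!catA.
apply: eq_periodic_factor => z.
  move=> [_ [n [z0 [[] -> ->]] <-]].
    (* The letter 0 itself is coded by the isolated word 1 of Z; its further images give the second
       family. *)
    case: n => [|n]; first by exists [:: 1]%N; [right|exact: conjugate_refl].
    by eexists; last exact: it2; left; exists n => //; right.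
  by eexists; last exact: itc; left; exists n => //; left.
move=> [[n _ []]|] ->.
- eexists; last exact/conjugate_sym/itc.
  by eexists=> //; exists n; eexists; split; [right|].
- eexists; last exact/conjugate_sym/it2.
  by eexists=> //; exists n.+1; eexists; split; [left|].
- exists [:: 1]%N; last exact: conjugate_refl.
  by exists [:: 0]%N => //; exists 0%N; eexists; split; [left|].
Qed.

(** * The words of the regular pentagon *)

(* The substitutions of the statement, conjugate to [pen_psi] and [pen_xi] on the
   words that matter. *)
Definition pen_psi' : seq (seq nat) :=
  [:: [:: 1; 2; 1; 2; 1]; [:: 2; 1]; [:: 2]]%N.
Definition pen_xi' : seq (seq nat) := [:: [:: 2; 1; 1; 1]; [:: 1]]%N.

Definition pen_Z' : set (seq nat) :=
  [set [:: 1]; [:: 1; 1; 2]]%N `|` (pen_ZD `|` subst pen_xi' @` pen_ZD).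

Lemma pen_ZD_letters z : pen_ZD z -> all (fun a => a < 2)%N z.
Proof.
move=> [n [z0 [z0E ->]]]; elim: n => [|n IH] /=; first by case: z0E => ->.
elim: (iter n _ z0) IH => //= a w IHw /andP[a2 /IHw]; rewrite subst_cons all_cat => ->.
by case: a a2 => [|[]].
Qed.

Definition nonzero_letter : pred nat := fun a => (0 < a < 3)%N.

(** The two substitutions differ only on the letter 0, which occurs in no image. *)
Lemma iter_pen_psi' m w : all nonzero_letter w ->
  iter m (subst pen_psi') w = iter m (subst pen_psi) w /\
  all nonzero_letter (iter m (subst pen_psi) w).
Proof.
move=> w1; elim: m => //= m [-> a1]; elim: (iter m _ w) a1 => //= a v IH.
move=> /andP[a1 /IH[e v1]]; rewrite !subst_cons e all_cat v1.
by case: a a1 => [|[|[]]].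
Qed.

(** Only the first application differs. On the letters 0 and 1 it is a conjugation by 21; afterwards
    the letter 0 has disappeared and both substitutions agree. *)
Lemma iter_pen_psi_conjugate m z : all (fun a => a < 2)%N z ->
  conjugate (iter m (subst pen_psi) z) (iter m (subst pen_psi') z).
Proof.
case: m => [_|m z2]; first exact: conjugate_refl.
have z1 : all nonzero_letter (subst pen_psi z).
  elim: z z2 => //= a z IH /andP[a2 /IH]; rewrite subst_cons all_cat => ->.
  by case: a a2 => [|[]].
rewrite !iterSr -(iter_pen_psi' m z1).1; apply: conjugate_sym.
elim: m => /= [|m IH]; last exact: conjugate_subst.
apply: (conjugate_subst2 (u := [:: 2; 1]%N) (P := fun a => a < 2)%N) => // a.
  by case: a => [|[]].
case: a => [|[|//]] _; first by exists [:: 1; 2; 1]%N.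
by exists [::].
Qed.

Lemma pen_xi_conjugate z : all (fun a => a < 2)%N z ->
  conjugate (subst pen_xi z) (subst pen_xi' z).
Proof.
move=> z2; apply: conjugate_sym.
apply: (conjugate_subst2 (u := [:: 1]%N) _ _ z2) => a; first by case: a => [|[]].
case: a => [|[|//]] _; first by exists [:: 2; 1; 1]%N.
by exists [::].
Qed.

Lemma pen_xi_nonzero z : all (fun a => a < 2)%N z -> all nonzero_letter (subst pen_xi z).
Proof.
elim: z => //= a z IH /andP[a2 /IH]; rewrite subst_cons all_cat => ->.
by case: a a2 => [|[]].
Qed.

Lemma pen_inc_id z : all (fun a => a < 2)%N z -> subst pen_inc z = z.
Proof.
elim: z => //= a z IH /andP[a2 /IH]; rewrite subst_cons => ->.
by case: a a2 => [|[]].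
Qed.

Lemma iter_pen_xi_conjugate m z : all (fun a => a < 2)%N z ->
  conjugate (iter m (subst pen_psi) (subst pen_xi z))
    (iter m (subst pen_psi') (subst pen_xi' z)).
Proof.
move=> z2; rewrite -(iter_pen_psi' m (pen_xi_nonzero z2)).1.
elim: m => [|m IH]; first exact: pen_xi_conjugate.
by rewrite !iterS; apply: conjugate_subst.
Qed.

Lemma eq_periodic_pentagon :
  periodic_factor (subst pen_code @` orbit_words pen_psi pen_Z) =
  periodic_factor (subst pen_code @` orbit_words pen_psi' pen_Z').
Proof.
apply: eq_periodic_factor => _ [_ [m [z0 [+ ->]]] <-].
- move=> [[] ->|[[z Zz <-]|[z Zz <-]]].
  + exists (subst pen_code (iter m (subst pen_psi') [:: 1]%N)).
      by eexists=> //; exists m; eexists; split; [left; left|].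
    by rewrite (iter_pen_psi' m _).1 //; exact: conjugate_refl.
  + exists (subst pen_code (iter m (subst pen_psi') [:: 1; 1; 2]%N)).
      by eexists=> //; exists m; eexists; split; [left; right|].
    by rewrite (iter_pen_psi' m _).1 //; exact: conjugate_refl.
  + have z2 := pen_ZD_letters Zz; rewrite (pen_inc_id z2).
    exists (subst pen_code (iter m (subst pen_psi') z)).
      by eexists=> //; exists m, z; split; [right; left|].
    exact/conjugate_subst/iter_pen_psi_conjugate.
  + have z2 := pen_ZD_letters Zz.
    exists (subst pen_code (iter m (subst pen_psi') (subst pen_xi' z))).
      by eexists=> //; exists m; eexists; split; [right; right; exists z|].
    exact/conjugate_subst/iter_pen_xi_conjugate.
- move=> [[] ->|[Zz|[z Zz <-]]].
  + exists (subst pen_code (iter m (subst pen_psi) [:: 1]%N)).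
      by eexists=> //; exists m; eexists; split; [left; left|].
    by rewrite (iter_pen_psi' m _).1 //; exact: conjugate_refl.
  + exists (subst pen_code (iter m (subst pen_psi) [:: 1; 1; 2]%N)).
      by eexists=> //; exists m; eexists; split; [left; right|].
    by rewrite (iter_pen_psi' m _).1 //; exact: conjugate_refl.
  + have z2 := pen_ZD_letters Zz.
    exists (subst pen_code (iter m (subst pen_psi) z0)).
      eexists=> //; exists m, z0; split=> //; right; left; exists z0 => //.
      exact: pen_inc_id.
    exact/conjugate_sym/conjugate_subst/iter_pen_psi_conjugate.
  + have z2 := pen_ZD_letters Zz.
    exists (subst pen_code (iter m (subst pen_psi) (subst pen_xi z))).
      by eexists=> //; exists m; eexists; split; [right; right; exists z|].
    exact/conjugate_sym/conjugate_subst/iter_pen_xi_conjugate.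
Qed.

(* The blocks 1, 2 and 23 as words of the free group. *)
Definition block (a : nat) : seq gen :=
  nth [::] [:: [:: x1]; [:: x2]; [:: x2; x3]] a.

Definition blocks (w : seq nat) : seq gen := flatten [seq block a | a <- w].

Lemma blocks_cons a w : blocks (a :: w) = block a ++ blocks w.
Proof. by []. Qed.

Lemma blocks_cat u v : blocks (u ++ v) = blocks u ++ blocks v.
Proof. by rewrite /blocks map_cat flatten_cat. Qed.

Lemma spell_blocks w : all (fun a => a < 3)%N w ->
  spell (pos (blocks w)) = pos (subst pen_code w).
Proof.
elim: w => //= a w IH /andP[a3 /IH]; rewrite blocks_cons subst_cons.
by rewrite /pos /spell !map_cat => ->; case: a a3 => [|[|[]]].
Qed.

(** No cancellation occurs between positive letters. *)
Lemma reduce_pos_cat (A : eqType) (s t : seq A) w :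
  reduce w = pos t -> reduce (pos s ++ w) = pos (s ++ t).
Proof.
move=> e; elim: s => //= a s; rewrite /reduce /= -/(reduce _) => ->.
case: (s ++ t) => //= c v.
by rewrite /signed_inv xpair_eqE andbF.
Qed.

(* The inverse letter produced by [x3] cancels the end of the image of the [x2]
   before it. *)
Lemma psi_blocks w : all (fun a => a < 3)%N w ->
  psi (pos (blocks w)) = pos (blocks (subst pen_psi' w)).
Proof.
rewrite /psi /endo; elim: w => // a w IH /andP[a3 /IH].
rewrite blocks_cons subst_cons blocks_cat /pos map_cat map_cat flatten_cat -!/(pos _).
set v := flatten _ => {}IH.
case: a a3 => [|[|[|//]]] _.
- exact: (reduce_pos_cat [:: x2; x2; x3; x2; x2; x3; x2] IH).
- exact: (reduce_pos_cat [:: x2; x3; x2] IH).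
- apply: (@reduce_pos_cat _ [:: x2; x3] _ [:: (x2, true), (x2, false) & v]).
  (* The inverse letter cancels with an [x2] at the start of the reduced [v] if there is one, and
     otherwise with the [x2] before it; the result is the same. *)
  rewrite /reduce /= -/(reduce v) IH.
  case: (blocks _) => [|[] [|c t]] //=.
  by rewrite xpair_eqE andbF.
Qed.

Lemma sigma_blocks w : all (fun a => a < 2)%N w ->
  sigma (pos (blocks w)) = pos (blocks (subst pen_sigma w)).
Proof.
rewrite /sigma /endo; elim: w => // a w IH /andP[a2 /IH].
rewrite blocks_cons subst_cons blocks_cat /pos map_cat map_cat flatten_cat -!/(pos _).
set v := flatten _ => {}IH; case: a a2 => [|[|//]] _.
- exact: (reduce_pos_cat [:: x1; x1; x2; x1; x2; x1; x1] IH).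
- exact: (reduce_pos_cat [:: x1; x1; x1] IH).
Qed.

Lemma xi_blocks w : all (fun a => a < 2)%N w ->
  xi (pos (blocks w)) = pos (blocks (subst pen_xi' w)).
Proof.
rewrite /xi /endo; elim: w => // a w IH /andP[a2 /IH].
rewrite blocks_cons subst_cons blocks_cat /pos map_cat map_cat flatten_cat -!/(pos _).
set v := flatten _ => {}IH; case: a a2 => [|[|//]] _.
- exact: (reduce_pos_cat [:: x2; x3; x2; x2; x2] IH).
- exact: (reduce_pos_cat [:: x2] IH).
Qed.

Lemma iter_sigma_blocks n z : all (fun a => a < 2)%N z ->
  iter n sigma (pos (blocks z)) = pos (blocks (iter n (subst pen_sigma) z)) /\
  all (fun a => a < 2)%N (iter n (subst pen_sigma) z).
Proof.
move=> z2; elim: n => //= n [-> a2]; rewrite sigma_blocks //; split=> //.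
elim: (iter n _ z) a2 => //= a w IH /andP[a2 /IH]; rewrite subst_cons all_cat => ->.
by case: a a2 => [|[]].
Qed.

Lemma iter_psi_blocks n z : all (fun a => a < 3)%N z ->
  iter n psi (pos (blocks z)) = pos (blocks (iter n (subst pen_psi') z)) /\
  all (fun a => a < 3)%N (iter n (subst pen_psi') z).
Proof.
move=> z2; elim: n => //= n [-> a2]; rewrite psi_blocks //; split=> //.
elim: (iter n _ z) a2 => //= a w IH /andP[a2 /IH]; rewrite subst_cons all_cat => ->.
by case: a a2 => [|[|[]]].
Qed.

Lemma pen_Z'_letters z : orbit_words pen_psi' pen_Z' z -> all (fun a => a < 3)%N z.
Proof.
move=> [n [z0 [z0Z ->]]]; apply: (iter_psi_blocks n _).2.
have lt23 w : all (fun a => a < 2)%N w -> all (fun a => a < 3)%N w.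
  by apply: sub_all => a /ltnW.
case: z0Z => [[] -> //|[/pen_ZD_letters/lt23 //|[u /pen_ZD_letters u2 <-]]].
elim: u u2 => //= a w IH /andP[a2 /IH]; rewrite subst_cons all_cat => ->.
by case: a a2 => [|[]].
Qed.

Lemma Z_pentagonE :
  Z_pentagon = (fun w => pos (blocks w)) @` orbit_words pen_psi' pen_Z'.
Proof.
have lt23 w : all (fun a => a < 2)%N w -> all (fun a => a < 3)%N w.
  by apply: sub_all => a /ltnW.
have D1 n : pen_ZD (iter n (subst pen_sigma) [:: 0]%N) by exists n, [:: 0]%N; split; [left|].
have D2 n : pen_ZD (iter n (subst pen_sigma) [:: 0; 1]%N).
  by exists n, [:: 0; 1]%N; split; [right|].
have xi3 w : all (fun a => a < 2)%N w -> all (fun a => a < 3)%N (subst pen_xi' w).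
  elim: w => //= a w IH /andP[a2 /IH]; rewrite subst_cons all_cat => ->.
  by case: a a2 => [|[]].
have s1 n := iter_sigma_blocks n (isT : all (fun a => a < 2)%N [:: 0]%N).
have s2 n := iter_sigma_blocks n (isT : all (fun a => a < 2)%N [:: 0; 1]%N).
apply/seteqP; split=> w.
- move=> [[[n _ []]|[n _ [m _ []]]]|[n _ [m _ []]]] ->.
  (* The first family of Z is the case where [psi] is applied zero times. *)
  + exists (iter n (subst pen_sigma) [:: 0]%N); last by rewrite -(s1 n).1.
    by apply: sub_orbit_words; right; left.
  + exists (iter n (subst pen_sigma) [:: 0; 1]%N); last by rewrite -(s2 n).1.
    by apply: sub_orbit_words; right; left.
  + exists (iter m (subst pen_psi') [:: 1]%N); last by rewrite -(iter_psi_blocks m _).1.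
    by exists m; eexists; split; [left; left|].
  + exists (iter m (subst pen_psi') [:: 1; 1; 2]%N);
      last by rewrite -(iter_psi_blocks m _).1.
    by exists m; eexists; split; [left; right|].
  + exists (iter m (subst pen_psi') (iter n (subst pen_sigma) [:: 0]%N)).
      by exists m; eexists; split; [right; left; exact: (D1 n)|].
    by rewrite -(iter_psi_blocks m (lt23 _ (s1 n).2)).1 -(s1 n).1.
  + exists (iter m (subst pen_psi') (iter n (subst pen_sigma) [:: 0; 1]%N)).
      by exists m; eexists; split; [right; left; exact: (D2 n)|].
    by rewrite -(iter_psi_blocks m (lt23 _ (s2 n).2)).1 -(s2 n).1.
  + exists (iter m (subst pen_psi') (subst pen_xi' (iter n (subst pen_sigma) [:: 0]%N))).
      by exists m; eexists; split; [right; right; eexists; [exact: (D1 n)|]|].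
    by rewrite -(iter_psi_blocks m (xi3 _ (s1 n).2)).1 -xi_blocks ?(s1 n).2 // -(s1 n).1.
  + exists (iter m (subst pen_psi') (subst pen_xi' (iter n (subst pen_sigma) [:: 0; 1]%N))).
      by exists m; eexists; split; [right; right; eexists; [exact: (D2 n)|]|].
    by rewrite -(iter_psi_blocks m (xi3 _ (s2 n).2)).1 -xi_blocks ?(s2 n).2 // -(s2 n).1.
- move=> [_ [m [z0 [+ ->]]] <-] => -[[]|[[n [z1 [[]]]]|[z [n [z1 [[]]]]]]].
  + move=> ->; left; right; exists 0%N => //; exists m => //; constructor 1.
    by rewrite -(iter_psi_blocks m _).1.
  + move=> ->; left; right; exists 0%N => //; exists m => //; constructor 2.
    by rewrite -(iter_psi_blocks m _).1.
  + move=> -> ->; left; right; exists n => //; exists m => //; constructor 3.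
    by rewrite -(iter_psi_blocks m (lt23 _ (s1 n).2)).1 -(s1 n).1.
  + move=> -> ->; left; right; exists n => //; exists m => //; constructor 4.
    by rewrite -(iter_psi_blocks m (lt23 _ (s2 n).2)).1 -(s2 n).1.
  + move=> -> -> <-; right; exists n => //; exists m => //; left.
    by rewrite -(iter_psi_blocks m (xi3 _ (s1 n).2)).1 -xi_blocks ?(s1 n).2 // -(s1 n).1.
  + move=> -> -> <-; right; exists n => //; exists m => //; right.
    by rewrite -(iter_psi_blocks m (xi3 _ (s2 n).2)).1 -xi_blocks ?(s2 n).2 // -(s2 n).1.
Qed.

Lemma subst_neq0 psi n z : all (fun a => a < n)%N z ->
  all (fun a => letter_image psi a != [::]) (iota 0 n) ->
  z <> [::] -> subst psi z <> [::].
Proof.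
case: z => // a z /andP[an _] /allP/(_ a); rewrite mem_iota => /(_ an) a0 _.
by rewrite subst_cons; case: (letter_image _ _) a0.
Qed.

Lemma pen_Z'_neq0 z : orbit_words pen_psi' pen_Z' z -> z <> [::].
Proof.
have ZD0 w : pen_ZD w -> w <> [::].
  move=> [n [z0 [Z0 ->]]]; elim: n => [|n IH]; first by case: Z0 => ->.
  by apply: (@subst_neq0 _ 2) => //; apply: pen_ZD_letters; exists n, z0.
move=> [n [z0 [Z0 ->]]]; elim: n => [|n IH].
  case: Z0 => [[] ->|[/ZD0|[w wD <-]]] //.
  by apply: (@subst_neq0 _ 2) => //; [exact: pen_ZD_letters|exact: ZD0].
by apply: (@subst_neq0 _ 3) => //; apply: pen_Z'_letters; exists n, z0.
Qed.

Lemma periodic_pentagon :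
  [set pos w | w in periodic_factor (subst pen_code @` orbit_words pen_psi pen_Z)] =
  periodic_factors [set spell z | z in Z_pentagon].
Proof.
rewrite eq_periodic_pentagon -(@periodic_factor_map (nat * bool)%type _ (fun a => (a, true))).
rewrite periodic_factorsE; last first.
  rewrite Z_pentagonE => _ [_ [z Zz <-] <-].
  move: (pen_Z'_letters Zz) (pen_Z'_neq0 Zz); case: z {Zz} => // a z /andP[a3 _] _.
  by case: a a3 => [|[|[]]].
congr periodic_factor; rewrite Z_pentagonE; apply/seteqP; split=> w.
  move=> [_ [z Zz <-] <-]; exists (pos (blocks z)); first by exists z.
  exact/spell_blocks/pen_Z'_letters.
move=> [_ [z Zz <-] <-]; exists (subst pen_code z); first by exists z.
exact/esym/spell_blocks/pen_Z'_letters.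
Qed.

(** * Regular polygons in affine coordinates *)

Section RegularPolygon.
Variables (R : realType) (k : nat) (c v : R * R).
Hypotheses (k_gt2 : (2 < k)%N) (v_neq0 : v <> 0).
Implicit Types (M Q u w : R * R) (i j m n : nat).

Let theta : R := 2 * pi / k%:R.
Let t : R := 2 * cos theta.
Local Notation A := (vertex k c v).

Lemma addCK (V : zmodType) (x y : V) : x + y - x = y.
Proof. by rewrite addrAC subrr add0r. Qed.

Lemma kR_gt0 : 0 < k%:R :> R.
Proof. by rewrite ltr0n; apply: leq_trans k_gt2. Qed.

Lemma rotD a b w : rot (a + b) w = rot a (rot b w).
Proof. by rewrite /rot cosD sinD /=; congr pair; ring. Qed.

Lemma rot0 w : rot 0 w = w.
Proof. by case: w => x y; rewrite /rot cos0 sin0 /=; congr pair; ring. Qed.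

Lemma rot_add a u w : rot a (u + w) = rot a u + rot a w.
Proof. by rewrite /rot /=; congr pair => /=; ring. Qed.

Lemma rot_opp a u : rot a (- u) = - rot a u.
Proof. by rewrite /rot /=; congr pair => /=; ring. Qed.

Lemma cross_rot a u w : cross (rot a u) (rot a w) = cross u w.
Proof.
rewrite /cross /rot /=.
have -> : (cos a * u.1 - sin a * u.2) * (sin a * w.1 + cos a * w.2) -
    (sin a * u.1 + cos a * u.2) * (cos a * w.1 - sin a * w.2) =
  (cos a ^+ 2 + sin a ^+ 2) * (u.1 * w.2 - u.2 * w.1) by ring.
by rewrite cos2Dsin2 mul1r.
Qed.

Definition turn M : R * R := c + rot theta (M - c).

Lemma turnK : cancel turn (rotR k c).
Proof.
move=> M; by rewrite /rotR /turn addCK -rotD addNr rot0 addrC subrK.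
Qed.

Lemma rotRK : cancel (rotR k c) turn.
Proof.
move=> M; by rewrite /rotR /turn addCK -rotD subrr rot0 addrC subrK.
Qed.

Lemma vertexS i : A i.+1 = turn (A i).
Proof.
rewrite /turn /vertex addCK -rotD; congr (c + rot _ v).
by rewrite /theta -natr1; field; rewrite gt_eqF ?kR_gt0.
Qed.

Lemma vertexDk i : A (i + k) = A i.
Proof.
rewrite /vertex; congr (c + _).
have -> : 2 * pi * (i + k)%:R / k%:R = 2 * pi * i%:R / k%:R + pi *+ 2 :> R.
  by rewrite natrD mulr2n; field; rewrite gt_eqF ?kR_gt0.
by rewrite /rot cosD2pi sinD2pi.
Qed.

Lemma vertexDMk i n : A (i + n * k) = A i.
Proof. by elim: n => [|n IH]; rewrite ?mul0n ?addn0 // mulSn addnCA addnC vertexDk. Qed.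

Lemma turnB M Q : turn M - turn Q = rot theta (M - Q).
Proof.
rewrite /turn opprD addrACA subrr add0r -rot_opp -rot_add.
by congr rot; rewrite opprB addrA subrK.
Qed.

Definition side_vector i : R * R := A i.+1 - A i.

Lemma edgeS i : side_vector i.+1 = rot theta (side_vector i).
Proof.
by rewrite /side_vector (vertexS i.+1) {2}(vertexS i) turnB.
Qed.

(** Cayley-Hamilton for a rotation, of trace [t] and determinant 1. *)
Lemma rot2 w : rot theta (rot theta w) = t *: rot theta w - w.
Proof.
have := cos2Dsin2 theta; rewrite /rot /t /= => H.
congr pair => /=; rewrite /GRing.scale /=.
- transitivity ((2 * cos theta ^+ 2 - (cos theta ^+ 2 + sin theta ^+ 2)) * w.1 -
    2 * cos theta * sin theta * w.2); first by ring.
  by rewrite H; ring.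
- transitivity ((2 * cos theta ^+ 2 - (cos theta ^+ 2 + sin theta ^+ 2)) * w.2 +
    2 * cos theta * sin theta * w.1); first by ring.
  by rewrite H; ring.
Qed.

Lemma theta_lt_pi : 0 < theta < pi.
Proof.
have k0 := kR_gt0; have p0 := pi_gt0 R; rewrite /theta; apply/andP; split.
  by rewrite divr_gt0 // mulr_gt0.
by rewrite ltr_pdivrMr // mulrC ltr_pM2l // ltr_nat.
Qed.

Lemma sin_theta_gt0 : 0 < sin theta.
Proof. exact/sin_gt0_pi/theta_lt_pi. Qed.

Definition area : R := cross (side_vector 0) (side_vector 1).

Lemma area_gt0 : 0 < area.
Proof.
have s0 := sin_theta_gt0; have cs := cos2Dsin2 theta.
have v0 : 0 < v.1 ^+ 2 + v.2 ^+ 2.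
  have [a0 b0] := (sqr_ge0 v.1, sqr_ge0 v.2).
  rewrite lt_def addr_ge0 // andbT; apply/eqP => /eqP.
  rewrite paddr_eq0 // !sqrf_eq0 => /andP[/eqP v1 /eqP v2].
  by apply: v_neq0; move: v1 v2; case: (v) => /= ? ? -> ->.
have -> : area = sin theta * ((side_vector 0).1 ^+ 2 + (side_vector 0).2 ^+ 2).
  by rewrite /area edgeS /cross /rot /=; ring.
have -> : side_vector 0 = rot theta v - v.
  rewrite /side_vector vertexS /turn /vertex mulr0 mul0r rot0.
  by rewrite addCK opprD addrACA subrr add0r.
rewrite mulr_gt0 //.
have -> : (rot theta v - v).1 ^+ 2 + (rot theta v - v).2 ^+ 2 =
    (cos theta ^+ 2 + sin theta ^+ 2 + 1 - 2 * cos theta) * (v.1 ^+ 2 + v.2 ^+ 2).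
  by rewrite /rot /=; ring.
by rewrite cs mulr_gt0 //; nra.
Qed.

Lemma cross_edge i : cross (side_vector i) (side_vector i.+1) = area.
Proof. by elim: i => // i IH; rewrite edgeS [side_vector i.+2]edgeS cross_rot IH. Qed.

(* The signed distance to the line through the vertices [A i] and [A (i + 1)],
   normalised to be 1 at the vertex [A (i + 2)]. *)
Definition side_dist i M : R := cross (side_vector i) (M - A i) / area.

Lemma edgeDk i : side_vector (i + k) = side_vector i.
Proof. by rewrite /side_vector -addSn !vertexDk. Qed.

Lemma distDk i M : side_dist (i + k) M = side_dist i M.
Proof. by rewrite /side_dist edgeDk vertexDk. Qed.

Lemma distDMk i n M : side_dist (i + n * k) M = side_dist i M.
Proof. by elim: n => [|n IH]; rewrite ?mul0n ?addn0 // mulSn addnCA addnC distDk. Qed.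

Lemma dist_turn i M : side_dist i.+1 (turn M) = side_dist i M.
Proof.
by rewrite /side_dist edgeS vertexS turnB cross_rot.
Qed.

Lemma dist_rotR i M : side_dist i (rotR k c M) = side_dist i.+1 M.
Proof. by rewrite -{2}[M]rotRK dist_turn. Qed.

Definition offset m : R := side_dist 0 (A m).

Lemma dist_vertex i m : side_dist i (A (i + m)) = offset m.
Proof. by elim: i => // i IH; rewrite addSn vertexS dist_turn. Qed.

Lemma area_neq0 : area != 0.
Proof. by rewrite gt_eqF ?area_gt0. Qed.

Lemma dist_symmetry i Q M : side_dist i (central_symmetry Q M) = 2 * side_dist i Q - side_dist i M.
Proof. by rewrite /side_dist /central_symmetry /cross /=; field; exact: area_neq0. Qed.

Lemma offset0 : offset 0 = 0.
Proof. by rewrite /offset /side_dist subrr /cross /=; ring. Qed.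

Lemma offset1 : offset 1 = 0.
Proof. by rewrite /offset /side_dist -/(side_vector 0) /cross /=; ring. Qed.

Lemma offset2 : offset 2 = 1.
Proof.
have -> : offset 2 = area / area by rewrite /offset /side_dist /area /cross /side_vector /=; ring.
by rewrite divff ?area_neq0.
Qed.

Lemma cross_edge2 i u : cross (side_vector i.+2) u =
  t * cross (side_vector i.+1) u - cross (side_vector i) u.
Proof.
by rewrite edgeS edgeS rot2 -edgeS /cross /= /GRing.scale /=; ring.
Qed.

(** By [rot2] applied around the center, the defect of the linear recurrence is the same for all
    [m]; the first three offsets show that it is 1. *)
Lemma offsetSS m : offset m.+2 = t * offset m.+1 - offset m + 1.
Proof.
have e n : A n.+2 = c + t *: (A n.+1 - c) - (A n - c).
  rewrite (vertexS n.+1) {1}/turn vertexS /turn -/theta.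
  by rewrite addCK rot2 addrA.
have aff n : offset n.+2 - t * offset n.+1 + offset n = (2 - t) * side_dist 0 c.
  by rewrite /offset e /side_dist /cross /= /GRing.scale /=; field; exact: area_neq0.
have := aff 0; rewrite -(aff m) offset0 offset1 offset2; lra.
Qed.

(* The cone V_0 is where both coordinates are nonnegative. *)
Definition coords M : R * R := (- side_dist k.-1 M, side_dist 0 M).

Lemma coords_onto x : exists M, coords M = x.
Proof.
exists (A 0 - x.2 *: side_vector k.-1 - x.1 *: side_vector 0).
have k1 : k = k.-1.+1 by rewrite prednK // (ltn_trans _ k_gt2).
have Ak : A k = A 0 by rewrite -[k in A k]add0n vertexDk.
have ek : side_vector k = side_vector 0 by rewrite -[k in side_vector k]add0n edgeDk.
have := cross_edge k.-1; rewrite -k1 ek => ce.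
case: x => p q; rewrite /coords /side_dist /=; congr pair.
- have -> : A k.-1 = A 0 - side_vector k.-1 by rewrite /side_vector -k1 Ak opprB addrC subrK.
  have -> : cross (side_vector k.-1) (A 0 - q *: side_vector k.-1 -
        p *: side_vector 0 - (A 0 - side_vector k.-1)) =
      - p * cross (side_vector k.-1) (side_vector 0).
    by rewrite /cross /= /GRing.scale /=; ring.
  by rewrite ce mulfK ?area_neq0 // opprK.
- have -> : cross (side_vector 0) (A 0 - q *: side_vector k.-1 - p *: side_vector 0 - A 0) =
      q * cross (side_vector k.-1) (side_vector 0).
    by rewrite /cross /= /GRing.scale /=; ring.
  by rewrite ce mulfK ?area_neq0.
Qed.

(* In the basis of the two sides at [A i.+1], the vertex [A (i.+1 + m)] has
   coordinates [offset m] and [offset m.+1]. *)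
Lemma cross_vertices i m M : cross (A i.+1 - M) (A (i.+1 + m) - M) =
  area * (side_dist i.+1 M * offset m.+1 - side_dist i M * offset m).
Proof.
(* The Grassmann-Pluecker relation between four vectors of the plane. *)
have pl u u' w : cross (side_vector i) (side_vector i.+1) * cross u w =
    cross (side_vector i) u * cross (side_vector i.+1) w -
    cross (side_vector i) w * cross (side_vector i.+1) u.
  by rewrite /cross; ring.
apply: (mulfI area_neq0).
have -> : cross (A i.+1 - M) (A (i.+1 + m) - M) =
    cross (A i.+1 - M) (A (i.+1 + m) - A i.+1) by rewrite /cross /=; ring.
rewrite -{1}(cross_edge i) pl //.
have d1 : area * offset m = cross (side_vector i.+1) (A (i.+1 + m) - A i.+1).
  by rewrite -(dist_vertex i.+1) /side_dist mulrC divfK ?area_neq0.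
have d2 : area * offset m.+1 = cross (side_vector i) (A (i.+1 + m) - A i.+1).
  rewrite -(dist_vertex i) addnS -addSn /side_dist mulrC divfK ?area_neq0 //.
  by rewrite /side_vector /cross /=; ring.
have d3 : area * side_dist i M = - cross (side_vector i) (A i.+1 - M).
  by rewrite /side_dist mulrC divfK ?area_neq0 // /side_vector /cross /=; ring.
have d4 : area * side_dist i.+1 M = - cross (side_vector i.+1) (A i.+1 - M).
  by rewrite /side_dist mulrC divfK ?area_neq0 // /side_vector /cross /=; ring.
rewrite -d1 -d2; apply/eqP; rewrite -subr_eq0; apply/eqP.
transitivity (area * offset m.+1 *
  (- cross (side_vector i.+1) (A i.+1 - M) - area * side_dist i.+1 M)
  - area * offset m * (- cross (side_vector i) (A i.+1 - M) - area * side_dist i M)); first by ring.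
by rewrite d3 d4 !subrr !mulr0 subrr.
Qed.

Lemma vertex_from i j : exists2 m, (m < k)%N &
  [/\ j = i + m %[mod k], A j = A (i + m) & forall M, side_dist j M = side_dist (i + m) M].
Proof.
have k0 : (0 < k)%N by apply: leq_trans k_gt2.
(* Then [i + n] equals [j + i * k], so [n] represents [j - i] modulo [k] without subtraction. *)
pose n := (j + i * k.-1)%N.
have e : (j + i * k)%N = (i + (n %% k) + (n %/ k) * k)%N.
  rewrite -addnA [(n %% k + _)%N]addnC -divn_eq /n addnCA -mulnS prednK //.
exists (n %% k)%N; first by rewrite ltn_mod.
split=> [||M]; first by rewrite -(modnMDl i) addnC e addnC modnMDl.
- by rewrite -(vertexDMk j i) e vertexDMk.
- by rewrite -(distDMk j i) e distDMk.
Qed.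

Lemma in_polygon j : polygon k c v (A j).
Proof.
have k0 : (0 < k)%N by apply: leq_trans k_gt2.
rewrite (divn_eq j k) addnC vertexDMk.
have [i <-] : exists i : 'I_k, nat_of_ord i = (j %% k)%N.
  by exists (Ordinal (ltn_pmod j k0)).
exists (fun i' => (i' == i)%:R); split.
- by move=> i'; rewrite ler0n.
- rewrite (bigD1 i) //= eqxx big1 ?addr0 // => i'.
  by rewrite -val_eqE => /negPf /= ->.
- rewrite (bigD1 i) //= eqxx scale1r big1 ?addr0 // => i'.
  by rewrite -val_eqE => /negPf /= ->; rewrite scale0r.
Qed.

Lemma convex_cross u M Q : (forall j, 0 <= cross u (A j - M)) ->
  polygon k c v Q -> 0 <= cross u (Q - M).
Proof.
move=> H [w [w0 w1 ->]].
have s1 : (\sum_j w j *: A j).1 = \sum_j w j * (A j).1.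
  exact: (big_morph (fun x : R * R => x.1)).
have s2 : (\sum_j w j *: A j).2 = \sum_j w j * (A j).2.
  exact: (big_morph (fun x : R * R => x.2)).
have -> : cross u (\sum_j w j *: A j - M) = \sum_j w j * cross u (A j - M).
  transitivity (\sum_j (u.1 * (w j * (A j).2) - u.2 * (w j * (A j).1) -
      w j * (u.1 * M.2 - u.2 * M.1))).
    rewrite !sumrB -!mulr_sumr -mulr_suml w1 /cross /= s1 s2; ring.
  by apply: eq_bigr => j _; rewrite /cross /=; ring.
by apply: sumr_ge0 => j _; apply: mulr_ge0.
Qed.

Hypothesis offset_ge0 : forall m, 0 <= offset m.
Hypothesis offset_gt0 : forall m, (0 < m < k)%N -> 0 < offset m + offset m.+1.

Lemma polygon_dist j Q : polygon k c v Q -> 0 <= side_dist j Q.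
Proof.
move=> PQ; apply: divr_ge0; last exact/ltW/area_gt0.
apply: convex_cross PQ => i; have [m _ [_ -> _]] := vertex_from j i.
have -> : cross (side_vector j) (A (j + m) - A j) = offset m * area.
  by rewrite -(dist_vertex j) /side_dist divfK ?area_neq0.
by rewrite mulr_ge0 // ltW ?area_gt0.
Qed.

(* The points that see the polygon between their two tangents, the first one
   through the vertex [A i.+1]. *)
Definition sector i M : Prop := side_dist i M < 0 /\ 0 < side_dist i.+1 M.

Lemma sector_outside i M : sector i M -> ~ polygon k c v M.
Proof. by move=> [Mi _] /(polygon_dist i); rewrite leNgt Mi. Qed.

Lemma sector_cross_ge0 i j M :
  sector i M -> 0 <= cross (A i.+1 - M) (A j - M).
Proof.
move=> [Mi Mi1]; have [m _ [_ -> _]] := vertex_from i.+1 j.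
rewrite cross_vertices mulr_ge0 // ?(ltW area_gt0) //.
have := offset_ge0 m; have := offset_ge0 m.+1; nra.
Qed.

Lemma sector_cross_gt0 i j M :
  sector i M -> i != j %[mod k] -> 0 < cross (A i.+1 - M) (A j.+1 - M).
Proof.
move=> [Mi Mi1] ij; have [m mk [jm -> _]] := vertex_from i.+1 j.+1.
rewrite cross_vertices mulr_gt0 ?area_gt0 //.
have m0 : (0 < m)%N.
  rewrite lt0n; apply: contra ij => /eqP m0; move: jm; rewrite m0 addn0.
  by move=> /eqP; rewrite -(addn1 j) -(addn1 i) eqn_modDr eq_sym.
have o0 := offset_ge0 m; have o1 := offset_ge0 m.+1.
have om := offset_gt0 (introT andP (conj m0 mk)).
have a0 : 0 <= - side_dist i M * offset m by rewrite mulr_ge0 // oppr_ge0 ltW.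
have a1 : 0 <= side_dist i.+1 M * offset m.+1 by rewrite mulr_ge0 // ltW.
case: (ltP 0 (offset m)) => [om0|om0].
  have : 0 < - side_dist i M * offset m by rewrite mulr_gt0 // oppr_gt0.
  by rewrite mulNr; lra.
have o' : 0 < offset m.+1 by lra.
have : 0 < side_dist i.+1 M * offset m.+1 by rewrite mulr_gt0.
by rewrite mulNr in a0; lra.
Qed.

(** Otherwise, seen from [M], each of the two vertices would be strictly to the left of the
    other. *)
Lemma sector_inj i j M : sector i M -> sector j M -> i = j %[mod k].
Proof.
move=> Mi Mj; apply/eqP/negPn/negP => ij.
have := sector_cross_gt0 Mi ij; rewrite eq_sym in ij.
have := sector_cross_gt0 Mj ij.
have -> : cross (A j.+1 - M) (A i.+1 - M) = - cross (A i.+1 - M) (A j.+1 - M).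
  by rewrite /cross; ring.
lra.
Qed.

Lemma tangent_vertex j M : ~ polygon k c v M ->
  (forall i, 0 <= cross (A j - M) (A i - M)) \/
  (forall i, cross (A j - M) (A i - M) <= 0) ->
  tangent_dir k c v M (A j - M).
Proof.
move=> Mout H; split.
- by move=> /eqP; rewrite subr_eq0 => /eqP AM; apply: Mout; rewrite -AM; exact: in_polygon.
- exists (A j); split; last exact: in_polygon.
  by exists 1; rewrite /= ?ler01 // scale1r addrC subrK.
- case: H => H; [left|right] => Q PQ; first exact: convex_cross PQ.
  have -> : cross (A j - M) (Q - M) = - cross (- (A j - M)) (Q - M).
    by rewrite /cross /=; ring.
  rewrite oppr_le0; apply: convex_cross PQ => i.
  have -> : cross (- (A j - M)) (A i - M) = - cross (A j - M) (A i - M).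
    by rewrite /cross /=; ring.
  by rewrite oppr_ge0.
Qed.

Lemma sector_first_tangent i M : (forall j, side_dist j M != 0) -> sector i M ->
  on_first_tangent k c v M (A i.+1).
Proof.
move=> Moff Mi; have [Mi0 Mi1] := Mi; have Mout := sector_outside Mi.
(* Going round from side [i + 1], the first side of negative distance starts at the vertex of the
   second tangent; it exists because a full turn leads back to side [i]. *)
have exm : exists m, side_dist (i.+1 + m) M < 0.
  by exists k.-1; rewrite addSnnS prednK ?distDk // (ltn_trans _ k_gt2).
case: (ex_minnP exm) => -[|m] mlt0 mmin; first by move: mlt0; rewrite addn0 ltNge (ltW Mi1).
pose j := (i.+1 + m)%N.
have Mj : 0 < side_dist j M.
  by rewrite lt_def Moff leNgt /=; apply/negP => /mmin; rewrite ltnn.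
have Mj1 : side_dist j.+1 M < 0 by move: mlt0; rewrite addnS.
exists (A i.+1 - M), (A j.+1 - M); split.
- by apply: tangent_vertex => //; left=> l; apply: sector_cross_ge0.
- apply: tangent_vertex => //; right=> l.
  have [n _ [_ -> _]] := vertex_from j.+1 l.
  rewrite cross_vertices pmulr_rle0 ?area_gt0 //.
  by have := offset_ge0 n; have := offset_ge0 n.+1; nra.
- apply: sector_cross_gt0 => //; apply/negP => /eqP ij.
  have [n _ [jn _ e]] := vertex_from i.+1 j.+1.
  suff : side_dist i.+1 M = side_dist j.+1 M by lra.
  have : (n %% k = 0)%N.
    have : (i.+1 + n == i.+1 + 0 %[mod k]).
      by rewrite addn0 -jn -(addn1 j) -(addn1 i) eqn_modDr ij.
    by rewrite eqn_modDl mod0n => /eqP.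
  by move=> nk; rewrite e (divn_eq n k) nk addn0 distDMk.
- by exists 1; rewrite /= ?ler01 // scale1r addrC subrK.
Qed.

Lemma first_tangent_sector j M : (forall i, side_dist i M != 0) ->
  ~ polygon k c v M -> on_first_tangent k c v M (A j.+1) -> sector j M.
Proof.
move=> Moff Mout [u [u' [[u0 _ side] [_ [Q' [[s' /= s'0 Q'E] PQ']] _] uu' [s /= s0 sE]]]].
have s_gt0 : 0 < s.
  rewrite lt_def s0 andbT; apply/eqP => s00; apply: Mout.
  by move: sE; rewrite s00 scale0r addr0 => ->; exact: in_polygon.
(* The second tangent meets the polygon at a point strictly to the left of [u], as [M] is outside,
   so the polygon cannot be on the right of [u]. *)
have {}side Q : polygon k c v Q -> 0 <= cross u (Q - M).
  case: side => [|H]; first exact.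
  have := H Q' PQ'; rewrite -Q'E addCK.
  have -> : cross u (s' *: u') = s' * cross u u' by rewrite /cross /= /GRing.scale /=; ring.
  rewrite pmulr_lle0 // => s'le; case: Mout; move: PQ'; rewrite -Q'E.
  have -> : s' = 0 by lra.
  by rewrite scale0r addr0.
have AM Q : cross (A j.+1 - M) (Q - M) = s * cross u (Q - M).
  by rewrite -sE addCK /cross /= /GRing.scale /=; ring.
have H i : 0 <= cross (A j.+1 - M) (A i - M).
  by rewrite AM mulr_ge0 //; apply: side; exact: in_polygon.
have a0 := area_gt0.
have d1 : area * side_dist j M = - cross (A j.+1 - M) (A j - M).
  by rewrite /side_dist mulrC divfK ?area_neq0 // /side_vector /cross /=; ring.
have d2 : area * side_dist j.+1 M = cross (A j.+1 - M) (A j.+2 - M).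
  by rewrite /side_dist mulrC divfK ?area_neq0 // /side_vector /cross /=; ring.
split; rewrite lt_def.
- by rewrite eq_sym Moff -(pmulr_rle0 _ a0) d1 oppr_le0 H.
- by rewrite Moff -(pmulr_rge0 _ a0) d2 H.
Qed.

End RegularPolygon.

(** * The folded outer billiard map as a piecewise affine map *)

Lemma map_In (I : eqType) (T : Type) (f : I -> T) i (s : seq I) :
  i \in s -> List.In (f i) [seq f j | j <- s].
Proof.
elim: s => //= j s IH; rewrite inE => /orP[/eqP ->|/IH]; [by left|by right].
Qed.

Lemma closure_image (T : topologicalType) (f g : T -> T) (B : set T) :
  cancel f g -> cancel g f -> continuous f -> continuous g ->
  f @` closure B = closure (f @` B).
Proof.
move=> fK gK cf cg.
have sub (h : T -> T) C : continuous h -> h @` closure C `<=` closure (h @` C).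
  move=> ch _ [x xC <-] N hN; have [y [Cy Ny]] := xC _ (ch x _ hN).
  by exists (h y); split=> //; exists y.
apply/seteqP; split; first exact: sub.
move=> y yB; exists (g y); last exact: gK.
have : (g @` closure (f @` B)) (g y) by exists y.
move=> /(sub g (f @` B) cg); congr (closure _ _).
apply/seteqP; split=> [_ [_ [x Bx <-] <-]|x Bx]; first by rewrite fK.
by exists (f x); [exists x|exact: fK].
Qed.

(** The facts about a given polygon that are left to computation. When [b] holds, the condition on
    the third offset makes the offsets generate all of Z[phi]. *)
Definition regular_table k tau d b : bool :=
  let off := side_offset k d in
  [&& [&& zeq (off 0) z0, zeq (off 1) z0 & zeq (off 2) z1]%N,
      b ==> zeq (off 3%N) (zint 0 1),
      all (fun m => [&&
        zeq (off m.+2) (zadd (zsub (zmul tau (off m.+1)) (off m)) z1),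
        in_lattice b (off m), znneg (off m) &
        (m == 0)%N || zpos (zadd (off m) (off m.+1))]) (iota 0 k),
      disjoint_pieces (folded k tau d) &
      covered b (sides k tau d)
        [seq dom (piece_at (folded k tau d) i) | i <- iota 0 k] [:: form_p; form_q]].

Section FoldedBilliard.
Variables (R : realType) (k : nat) (c v : R * R) (phi : R).
Variables (tau : zphi) (d : seq zphi) (b : bool).
Hypotheses (k_gt2 : (2 < k)%N) (v_neq0 : v <> 0).
Hypotheses (phi_gt0 : 0 < phi) (phi_sqr : phi ^+ 2 = phi + 1).
Hypothesis tauE : 2 * cos (2 * pi / k%:R) = ev phi tau.
Hypothesis table : regular_table k tau d b.
Implicit Types (M Q : R * R) (i j m n : nat) (a : zphi).

Local Notation A := (vertex k c v).
Local Notation edge := (side_vector k c v).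
Local Notation area := (area k c v).
Local Notation dist := (side_dist k c v).
Local Notation offset := (offset k c v).
Local Notation coords := (coords k c v).
Local Notation sector := (sector k c v).
Local Notation singular := (singular k c v).
Local Notation ev := (ev phi).
Local Notation off := (side_offset k d).

Let k_gt0 : (0 < k)%N := ltn_trans (ltn0Sn 1) k_gt2.

Lemma offD m n : off (m %% k + n)%N = off (m + n)%N.
Proof. by rewrite /side_offset modnDml. Qed.

Lemma table_entry m : [/\ off m.+2 = zadd (zsub (zmul tau (off m.+1)) (off m)) z1,
  in_lattice b (off m), znneg (off m) &
  (m %% k == 0)%N || zpos (zadd (off m) (off m.+1))].
Proof.
have /and5P[_ _ /allP/(_ (m %% k)%N) + _ _] := table.
have E1 : off (m %% k)%N.+1 = off m.+1 by rewrite -addn1 offD addn1.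
have E2 : off (m %% k)%N.+2 = off m.+2 by rewrite -addn2 offD addn2.
have E0 : off (m %% k)%N = off m by rewrite -[in LHS](addn0 (m %% k)%N) offD addn0.
rewrite mem_iota ltn_mod k_gt0 E0 E1 E2.
by move=> /(_ isT)/and4P[/zeqP ? ? ? ?].
Qed.

Lemma offsetE m : offset m = ev (off m).
Proof.
suff [] : offset m = ev (off m) /\ offset m.+1 = ev (off m.+1) by [].
elim: m => [|m [IH IH1]].
  have /and5P[/and3P[/zeqP -> /zeqP -> _] _ _ _ _] := table.
  by rewrite ev0 offset0 offset1.
split=> //; have [-> _ _ _] := table_entry m.
by rewrite offsetSS // tauE !evD evN evM // IH IH1 ev1.
Qed.

Lemma offset_ge0 m : 0 <= offset m.
Proof. by rewrite offsetE; have [_ _ H _] := table_entry m; exact: znneg_ge0 H. Qed.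

Lemma offset_gt0 m : (0 < m < k)%N -> 0 < offset m + offset m.+1.
Proof.
move=> /andP[m0 mk]; have [_ _ _ H] := table_entry m.
rewrite modn_small // gtn_eqF //= in H.
by rewrite !offsetE -evD; exact: zpos_gt0 H.
Qed.

Lemma side_linearE j M : fev phi (side_linear tau j) (coords M) =
  cross (edge (j + k.-1)) (M - A 0) / area.
Proof.
have k1 : k.-1.+1 = k by rewrite prednK.
pose mu j := cross (edge (j + k.-1)) (M - A 0) / area.
suff [] : fev phi (side_linear2 tau j).1 (coords M) = mu j /\
    fev phi (side_linear2 tau j).2 (coords M) = mu j.+1 by [].
elim: j => [|j [IH IH1]] /=.
  rewrite fev_opp // /fev /= ev0 ev1 !mul1r !mul0r !addr0 add0r opprK.
  split; rewrite /mu ?add1n ?k1 ?add0n.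
    have -> : A 0 = A k.-1.+1 by rewrite k1; exact/esym/(vertexDk c v k_gt2 0).
    by rewrite /side_dist /side_vector; congr (_ / _); rewrite /cross /=; ring.
  by have -> : edge k = edge 0 := edgeDk c v k_gt2 0.
move: IH IH1; case: (side_linear2 tau j) => f g /= IH IH1; split=> //.
rewrite fev_sub // fev_scale // IH IH1 /mu !addSn cross_edge2 // tauE.
by field; exact: area_neq0.
Qed.

Lemma dist_side i M : (i < k)%N -> dist i M = fev phi (side k tau d i) (coords M).
Proof.
move=> ik; rewrite /side fev_sub // fev_const evN opprK side_linearE -offsetE.
rewrite addSnnS prednK // edgeDk // -(dist_vertex c v k_gt2 i) subnKC ?(ltnW ik) //.
rewrite (vertexDk c v k_gt2 0 : A k = A 0) /side_dist.
by rewrite -mulrDl; congr (_ / _); rewrite /cross /=; ring.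
Qed.

Lemma dist_mod i M : dist (i %% k) M = dist i M.
Proof. by rewrite [in RHS](divn_eq i k) addnC distDMk. Qed.

Lemma off_latticeP M : off_lattice phi b (sides k tau d) (coords M) <->
  forall i a, in_lattice b a -> dist i M != ev (zadd a a).
Proof.
split=> H.
  move=> i a ab; rewrite -dist_mod dist_side ?ltn_mod //; apply: H => //.
  by apply: map_In; rewrite mem_iota ltn_mod.
move=> l a lin ab; have [i] := in_map lin; rewrite mem_iota => /= ik ->.
by rewrite -dist_side //; apply: H.
Qed.

Lemma in_latticeB a a' : in_lattice b a -> in_lattice b a' -> in_lattice b (zsub a a').
Proof. by rewrite /in_lattice; case: (b) => //=; case: a a' => ? ? [? ?] /=; lia. Qed.

(** A reflection about a vertex changes the value [2 a] of a distance into [2 (off m - a)], which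
    stays in twice the lattice. *)
Lemma sing_set_dist n M : sing_set k c v n M ->
  exists i a, in_lattice b a /\ dist i M = ev (zadd a a).
Proof.
elim: n M => [|n IH] M /=.
  move=> [i ik [s _ <-]]; exists i, z0; split; first by case: (b).
  by rewrite evD ev0 addr0 /side_dist addCK /cross /= /GRing.scale /= /side_vector /=; ring.
move=> [j jk [Q /IH[i [a [ab e]]] <-]].
have [m _ [_ Aj _]] := vertex_from c v k_gt2 i j.
exists i, (zsub (off m) a); split.
  by apply: in_latticeB => //; have [] := table_entry m.
rewrite dist_symmetry // Aj dist_vertex // offsetE e !evD !evN; ring.
Qed.

Lemma dist_eq0_line i M : dist i M = 0 -> line (A i) (A i.+1) M.
Proof.
have a0 := area_gt0 c k_gt2 v_neq0.
move=> /eqP; rewrite mulf_eq0 invr_eq0 (gt_eqF a0) orbF => /eqP cr.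
have e0 : (edge i).1 ^+ 2 + (edge i).2 ^+ 2 != 0.
  apply/eqP => /eqP; rewrite paddr_eq0 ?sqr_ge0 // !sqrf_eq0 => /andP[/eqP e1 /eqP e2].
  by have := cross_edge c v k_gt2 i; rewrite {1}/cross e1 e2 !mul0r subr0; lra.
pose s := ((M - A i).1 * (edge i).1 + (M - A i).2 * (edge i).2) /
  ((edge i).1 ^+ 2 + (edge i).2 ^+ 2).
exists s => //.
have : s *: edge i = M - A i.
  move: cr; rewrite /s /cross; move: (M - A i) (edge i) e0 => [w1 w2] [e1 e2] /= e0 cr.
  have {}cr : e2 * w1 = e1 * w2 by apply/eqP; rewrite -subr_eq0 -oppr_eq0 opprB cr.
  congr pair; rewrite /GRing.scale /=; apply: (mulIf e0); rewrite mulrAC divfK //.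
  - transitivity (w1 * e1 ^+ 2 + e2 * (e1 * w2)); first by ring.
    by rewrite -cr; ring.
  - transitivity (w2 * e2 ^+ 2 + e1 * (e2 * w1)); first by ring.
    by rewrite cr; ring.
by rewrite /side_vector => ->; rewrite addrC subrK.
Qed.

(** The value 0 is taken on the lines of sigma_1. Reflections replace [a] by [off m - a], so two of
    them translate it by an offset; the offsets 1 and, for the pentagon, [phi] reach the whole
    lattice. *)
Lemma dist_singular i a M : in_lattice b a -> dist i M = ev (zadd a a) -> singular M.
Proof.
pose S a := forall i M, dist i M = ev (zadd a a) -> singular M.
suff : in_lattice b a -> S a by move=> /[apply]; apply.
have S0 : S z0.
  move=> {}i {}M; rewrite evD ev0 addr0 -dist_mod => /dist_eq0_line H.
  by exists 0%N => //; exists (i %% k)%N => //=; rewrite ltn_mod.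
have Ssym m a' : S a' -> S (zsub (off m) a').
  move=> Sa {}i {}M e.
  have [j jk [_ Aj _]] := vertex_from c v k_gt2 0 (i + m).
  have : singular (central_symmetry (A j) M).
    apply: (Sa i); rewrite dist_symmetry // -[j]add0n -Aj dist_vertex // offsetE e.
    by rewrite !evD !evN; ring.
  move=> [n _ Mn]; exists n.+1 => //; exists j => //=.
  by eexists; first exact: Mn; rewrite /central_symmetry opprB addrC subrK.
have /and5P[/and3P[/zeqP o0 _ /zeqP o2] /implyP o3 _ _ _] := table.
have SN a' : S a' -> S (zopp a').
  by move=> /(Ssym 0%N); rewrite o0; case: a'.
have SD m a' : S a' -> S (zadd (off m) a').
  move=> /SN/(Ssym m); congr S.
  by rewrite /zsub /zopp /zadd /= !Z.opp_involutive.
have SB m a' : S a' -> S (zadd (zopp (off m)) a').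
  move=> /(Ssym m)/SN; congr S; rewrite /zsub /zopp /zadd /=.
  by congr pair; lia.
have addN1 (n : Z) : Z.add (Zneg xH) n = Z.pred n by lia.
have S1 (n : Z) : S (n, Z0).
  elim/Z.peano_ind: n => [//|n /(SD 2%N)|n /(SB 2%N)]; rewrite o2.
  - by rewrite -[zadd _ _]/(Z.add (Zpos xH) n, Z0) Z.add_1_l.
  - by rewrite -[zadd _ _]/(Z.add (Zneg xH) n, Z0) addN1.
case: a => n1 n2; rewrite /in_lattice /=; case: (b) o3 => /=; last first.
  by move=> _ /Z.eqb_eq ->.
move=> /(_ isT)/zeqP o3 _.
elim/Z.peano_ind: n2 => [//|n2 /(SD 3%N)|n2 /(SB 3%N)]; rewrite o3.
- by rewrite -[zadd _ _]/(Z.add Z0 n1, Z.add (Zpos xH) n2) Z.add_1_l Z.add_0_l.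
- by rewrite -[zadd _ _]/(Z.add Z0 n1, Z.add (Zneg xH) n2) addN1 Z.add_0_l.
Qed.

Lemma singularP M : ~ singular M <-> off_lattice phi b (sides k tau d) (coords M).
Proof.
rewrite off_latticeP; split=> H.
  by move=> i a ab; apply/eqP => /(dist_singular ab).
by move=> [n _ /sing_set_dist[i [a [ab /eqP]]]]; apply/negP/H.
Qed.

Lemma nonsingular_dist i M : ~ singular M -> dist i M != 0.
Proof.
move=> /singularP/off_latticeP/(_ i z0); rewrite evD ev0 addr0; apply.
by case: (b).
Qed.

Lemma vertex_mod i j : i = j %[mod k] -> A i = A j.
Proof.
move=> ij; rewrite (divn_eq i k) (divn_eq j k) ij.
by rewrite ![(_ * k + _)%N]addnC !vertexDMk.
Qed.

Lemma vertex_pred i : A i = A (i + k.-1).+1.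
Proof. by rewrite -addnS prednK // vertexDk. Qed.

Lemma dist_pred i M : dist i M = dist (i + k.-1).+1 M.
Proof. by rewrite -addnS prednK // distDk. Qed.

Lemma sector_Aplus j M : ~ singular M -> sector j M ->
  domain k c v M /\ Aplus k c v M = A j.+1.
Proof.
move=> Mns Mj; have Moff i := nonsingular_dist i Mns.
have Mout := sector_outside k_gt2 v_neq0 offset_ge0 Mj; split=> //.
apply: xget_unique.
  split; first exact: (sector_first_tangent k_gt2 v_neq0 offset_ge0 offset_gt0 Moff Mj).
  exists (j.+1 %% k)%N; first by rewrite ltn_mod.
  by apply: vertex_mod; rewrite modn_mod.
move=> Q [Qt [i ik e]]; move: Qt; rewrite {Q}e vertex_pred => Qt.
have Mi := first_tangent_sector k_gt2 v_neq0 Moff Mout Qt.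
apply: vertex_mod; rewrite -(addn1 (i + _)) -(addn1 j) -modnDml -[in RHS]modnDml.
by rewrite (sector_inj k_gt2 v_neq0 offset_ge0 offset_gt0 Mi Mj).
Qed.

Lemma Aplus_sector i M : domain k c v M -> Aplus k c v M = A i ->
  sector (i + k.-1) M.
Proof.
move=> [Mout Mns]; have Moff j := nonsingular_dist j Mns.
rewrite /Aplus; set S := [set Q | _]; case: (pselect (exists Q, S Q)) => [exS|noS] e.
  have [+ _] := xgetPex M exS; rewrite e vertex_pred.
  exact: first_tangent_sector.
(* Without a tangent vertex [Aplus] would take its default value [M]; then [M] would be a vertex,
   which lies on a side line. *)
have MA : M = A i by rewrite -e xgetPN // => Q SQ; apply: noS; exists Q.
have := Moff i; rewrite MA -[X in A X]addn0 dist_vertex // offset0 //.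
by rewrite eqxx.
Qed.

Lemma cone_setE i : [set M | domain k c v M /\ Aplus k c v M = A i] =
  [set M | ~ singular M /\ sector (i + k.-1) M].
Proof.
apply/seteqP; split=> M /= [].
  by move=> Mdom /(Aplus_sector Mdom) Mi; split=> //; case: Mdom.
by move=> Mns /(sector_Aplus Mns); rewrite -vertex_pred.
Qed.

Lemma affine_continuous (x y z : R) : continuous (fun M : R * R => x * M.1 + y * M.2 + z).
Proof.
move=> M; apply: cvgD; last exact: cvg_cst.
by apply: cvgD; (apply: cvgM; first exact: cvg_cst); [exact: cvg_fst|exact: cvg_snd].
Qed.

Lemma affine_pair_continuous (x y z x' y' z' : R) : continuous
  (fun M : R * R => (x * M.1 + y * M.2 + z, x' * M.1 + y' * M.2 + z')).
Proof.
move=> M; apply: (@cvg_pair _ _ _ (nbhs M) (nbhs (x * M.1 + y * M.2 + z))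
  (nbhs (x' * M.1 + y' * M.2 + z'))); exact: affine_continuous.
Qed.

Lemma rot_continuous s Q : continuous (fun M => c + rot s (M - Q)).
Proof.
have -> : (fun M => c + rot s (M - Q)) = (fun M =>
    (cos s * M.1 + (- sin s) * M.2 + (c.1 - cos s * Q.1 + sin s * Q.2),
     sin s * M.1 + cos s * M.2 + (c.2 - sin s * Q.1 - cos s * Q.2))).
  by apply/funext => M; rewrite /rot; congr pair => /=; ring.
exact: affine_pair_continuous.
Qed.

Lemma side_dist_continuous i : continuous (dist i).
Proof.
have -> : dist i = (fun M => (- (edge i).2 / area) * M.1 + ((edge i).1 / area) * M.2 +
    ((edge i).2 * (A i).1 - (edge i).1 * (A i).2) / area).
  apply/funext => M; rewrite /side_dist /cross /=; field.
  exact: area_neq0.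
exact: affine_continuous.
Qed.

Lemma singular_rotR M : ~ singular M -> ~ singular (rotR k c M).
Proof.
move=> /singularP/off_latticeP H; apply/singularP/off_latticeP => i a ab.
by rewrite dist_rotR //; apply: H.
Qed.

Lemma singular_turn M : ~ singular M -> ~ singular (turn k c M).
Proof.
move=> /singularP/off_latticeP H; apply/singularP/off_latticeP => i a ab.
by rewrite dist_pred dist_turn //; apply: H.
Qed.

Lemma rotR_cone i : rotR k c @` cone k c v i.+1 = cone k c v i.
Proof.
rewrite /cone !cone_setE (closure_image (g := turn k c)); last 4 first.
- exact: rotRK.
- exact: turnK.
- exact: rot_continuous.
- exact: rot_continuous.
congr closure; apply/seteqP; split=> [_ [M [Mns [M1 M2]] <-]|M [Mns [M1 M2]]].
  split; first exact: singular_rotR.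
  by split; rewrite dist_rotR.
exists (turn k c M); last exact: turnK.
split; first exact: singular_turn.
by split; rewrite addSn dist_turn.
Qed.

Lemma iter_rotR_cone n i : iter n (rotR k c) @` cone k c v (n + i) = cone k c v i.
Proof.
elim: n i => [|n IH] i; first by rewrite image_id.
rewrite -(rotR_cone i) -(IH i.+1) addSnnS image_comp.
by [].
Qed.

Lemma dist_iter_rotR n j M : dist j (iter n (rotR k c) M) = dist (n + j) M.
Proof. by elim: n j => // n IH j; rewrite iterS dist_rotR // IH addSnnS. Qed.

(** The closure only gives weak inequalities, which become strict off Y because no distance vanishes
    there. *)
Lemma cone_sector i M : cone k c v i M -> ~ singular M -> sector (i + k.-1) M.
Proof.
move=> Mi Mns.
have sub B : closed B -> [set M | ~ singular M /\ sector (i + k.-1) M] `<=` B ->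
    cone k c v i `<=` B.
  move=> /closure_id cl SB; rewrite cl /cone cone_setE; exact: closureS.
have M1 : dist (i + k.-1) M <= 0.
  apply: (sub (dist (i + k.-1) @^-1` [set x | x <= 0])) Mi => [|Q [_ [/ltW]] //].
  by apply: preimage_closed (@closed_le R 0) => Q _; exact: side_dist_continuous.
have M2 : 0 <= dist (i + k.-1).+1 M.
  apply: (sub (dist (i + k.-1).+1 @^-1` [set x | 0 <= x])) Mi => [|Q [_ [_ /ltW]] //].
  by apply: preimage_closed (@closed_ge R 0) => Q _; exact: side_dist_continuous.
split; first by rewrite lt_neqAle nonsingular_dist.
by rewrite lt_neqAle eq_sym nonsingular_dist.
Qed.

Lemma in_cone i M : ~ singular M -> sector (i + k.-1) M -> cone k c v i M.
Proof. by move=> Mns Mi; apply: subset_closure; rewrite cone_setE. Qed.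

Lemma fold_indexE i M : (i < k)%N -> ~ singular M -> sector (i + k.-1) M ->
  fold_index k c v M = i.
Proof.
move=> ik Mns Mi; have Mc := in_cone Mns Mi.
have foldsi : folds k c v M i.
  by exists i => //; split=> //; rewrite -[RHS](iter_rotR_cone i 0) addn0.
have folds_ge n : folds k c v M n -> (i <= n)%N.
  move=> [i' i'k [Mi' e]].
  have i'i : i' = i.
    have := sector_inj k_gt2 v_neq0 offset_ge0 offset_gt0 Mi (cone_sector Mi' Mns).
    by move=> /eqP; rewrite eqn_modDr !modn_small // => /eqP.
  (* After [n < i] rotations the point would be both in V_0 and in V_(i-n), hence in two different
     sectors. *)
  rewrite leqNgt; apply/negP => ni; subst i'.
  have Nns : ~ singular (iter n (rotR k c) M).
    by elim: (n) => // n' IH; exact: singular_rotR.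
  have N0 : sector (0 + k.-1) (iter n (rotR k c) M).
    by apply: cone_sector => //; rewrite -e; exists M.
  have Ni : sector (i - n + k.-1) (iter n (rotR k c) M).
    by split; rewrite dist_iter_rotR ?addnS addnA subnKC ?(ltnW ni) //; case: Mi.
  have := sector_inj k_gt2 v_neq0 offset_ge0 offset_gt0 N0 Ni.
  move=> /eqP; rewrite eqn_modDr mod0n modn_small; first by move=> /eqP; lia.
  exact: leq_ltn_trans (leq_subr _ _) ik.
apply: xget_unique => // n [foldsn nmin].
by apply/eqP; rewrite eqn_leq nmin // folds_ge.
Qed.

Local Notation F := (folded k tau d).

Lemma piece_folded i : (i < k)%N -> piece_at F i =
  let g := folded_branch k tau d i in Piece [:: form_p; form_q; g.1; g.2] g.
Proof.
by move=> ik; rewrite /piece_at /folded (nth_map 0%N) ?size_iota // nth_iota.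
Qed.

Lemma dist_reflection j M : dist j (central_symmetry (A 0) M) =
  dist j (A 0) - cross (edge j) (M - A 0) / area.
Proof.
rewrite dist_symmetry // /side_dist /cross /=; field; exact: area_neq0.
Qed.

Lemma singular_reflection M : ~ singular M -> ~ singular (central_symmetry (A 0) M).
Proof.
move=> /singularP/off_latticeP H; apply/singularP/off_latticeP => i a ab.
have [m _ [_ Aj _]] := vertex_from c v k_gt2 i 0.
rewrite dist_symmetry // Aj dist_vertex // offsetE.
have [_ mb _ _] := table_entry m.
apply: contra (H i (zsub (off m) a) (in_latticeB mb ab)) => /eqP e.
have -> : dist i M = 2 * ev (off m) - ev (zadd a a) by rewrite -e; ring.
by apply/eqP; rewrite !evD !evN; ring.
Qed.

Lemma sector_coords M : sector k.-1 M <-> 0 < (coords M).1 /\ 0 < (coords M).2.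
Proof.
by rewrite /coords /= oppr_gt0 (dist_pred 0).
Qed.

Lemma folded_step i M : ~ singular M -> sector k.-1 M ->
  sat phi (dom (piece_at F i)) (coords M) ->
  [/\ fold_index k c v (outer_billiard k c v M) = i,
    coords (folded_map k c v M) = aev phi (mv (piece_at F i)) (coords M),
    ~ singular (folded_map k c v M) & sector k.-1 (folded_map k c v M)].
Proof.
move=> Mns M0 Mi; have ik : (i < k)%N.
  by have := sat_piece_lt Mi; rewrite size_map size_iota.
pose N := central_symmetry (A 0) M.
have TM : outer_billiard k c v M = N.
  by have [_ AM] := sector_Aplus Mns (M0 : sector (0 + k.-1) M);
    rewrite /outer_billiard AM -vertex_pred.
have g1 : fev phi (folded_branch k tau d i).1 (coords M) = - dist (i + k.-1) N.
  rewrite fev_sub // fev_const side_linearE -offsetE dist_reflection opprB.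
  (* The indices [i + k - 1] and [k + 1 - i] add up to [2 k], another number of the vertex A_0. *)
  congr (_ - _); rewrite -(dist_vertex c v k_gt2 (i + k.-1)).
  congr (dist _ _); rewrite -(vertexDMk c v k_gt2 0 2); congr vertex.
  by move: ik k_gt0; lia.
have g2 : fev phi (folded_branch k tau d i).2 (coords M) = dist i N.
  rewrite fev_sub // fev_const side_linearE -offsetE dist_reflection.
  rewrite addSnnS prednK // edgeDk //; congr (_ - _).
  rewrite -(dist_vertex c v k_gt2 i) subnKC ?(ltnW ik) //.
  by congr (dist _ _); exact: vertexDk k_gt2 0.
rewrite piece_folded //= in Mi *.
have Nns := singular_reflection Mns.
have Ni : sector (i + k.-1) N.
  move: Mi => /sat_cons[_ /sat_cons[_ /sat_cons[+ /sat_cons[+ _]]]].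
  by rewrite g1 g2 oppr_gt0 /sector -dist_pred.
have e : folded_map k c v M = iter i (rotR k c) N.
  by rewrite /folded_map TM (fold_indexE ik Nns Ni).
have eq_coords : coords (folded_map k c v M) = aev phi (folded_branch k tau d i) (coords M).
  by rewrite /aev g1 g2 e /coords !dist_iter_rotR addn0.
split=> //; first by rewrite TM (fold_indexE ik Nns Ni).
  by rewrite e; elim: (i) => // n IH; exact: singular_rotR.
by rewrite e; split; rewrite dist_iter_rotR ?addnS; case: Ni.
Qed.

Lemma coding_shift m i M : coding k c v M (m + i) = coding k c v (iter m (folded_map k c v) M) i.
Proof. by rewrite /coding addnC iterD. Qed.

Lemma coding_follows n M : ~ singular M -> sector k.-1 M ->
  follows phi F (mkseq (coding k c v M) n) (coords M).
Proof.
elim: n M => // n IH M Mns M0.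
have [i Mi] : exists i, sat phi (dom (piece_at F i)) (coords M).
  have /and5P[_ _ _ _ cov] := table.
  have [|L LF ML] := covered_sound phi_gt0 phi_sqr cov (iffLR (singularP M) Mns).
    have /sector_coords[] := M0; move: (coords M) => x x1 x2.
    by move=> f /= [<-|[<-|//]]; rewrite /fev /= ev0 ev1; lra.
  by have [i _ e] := in_map LF; exists i; rewrite -e.
have [ei ec Nns N0] := folded_step Mns M0 Mi.
have -> : mkseq (coding k c v M) n.+1 = i :: mkseq (coding k c v (folded_map k c v M)) n.
  rewrite /mkseq /= (iotaDl 1 0) -map_comp {1}/coding /= ei; congr cons.
  by apply: eq_map => i' /=; rewrite (coding_shift 1).
by have := IH _ Nns N0; rewrite ec => H; exact: (conj Mi H).
Qed.

(** A factor at position [m] of a coding is a prefix of the coding of the [m]-th iterate, so it is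
    enough to compare initial words. *)
Lemma languageE :
  language k c v = system_language phi b (sides k tau d) F.
Proof.
have /and5P[_ _ _ dF _] := table.
apply/seteqP; split=> w.
- move=> [M [M0 Mns] [m ->]].
  have {}M0 : sector k.-1 M := cone_sector M0 Mns.
  pose N := iter m (folded_map k c v) M.
  have [Nns N0] : ~ singular N /\ sector k.-1 N.
    rewrite /N; elim: (m) => // n [Nns N0].
    have := coding_follows 1 Nns N0; rewrite /mkseq /= => -[xi _].
    by have [] := folded_step Nns N0 xi.
  have -> : mkseq (fun i => coding k c v M (m + i)) (size w) =
      mkseq (coding k c v N) (size w).
    by apply: eq_mkseq => i; rewrite coding_shift.
  exists (coords N); have /sector_coords[x1 x2] := N0.
  by split=> //; [exact/singularP|exact: coding_follows].
- move=> [x [xoff x1 x2 xw]]; have [M e] := coords_onto c k_gt2 v_neq0 x; subst x.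
  have Mns : ~ singular M by apply/singularP.
  have M0 : sector k.-1 M by apply/sector_coords.
  exists M; first by split=> //; exact: (in_cone (i := 0) Mns M0).
  exists 0%N; apply: (follows_inj phi_gt0 phi_sqr dF _ xw); first by rewrite size_mkseq.
  exact: coding_follows.
Qed.

End FoldedBilliard.

(** * The four polygons *)

Section Trigonometry.
Variable R : realType.
Local Notation cosk k := (cos (2 * pi / k%:R) : R).

Lemma cosk_lt1 k : (2 < k)%N -> -1 < cosk k < 1.
Proof.
move=> k2; have := sin_theta_gt0 R k2; have := cos2Dsin2 (2 * pi / k%:R : R).
by move: (cos _) (sin _) => x y; nra.
Qed.

Lemma cos2x (x : R) : cos (x + x) = 2 * cos x ^+ 2 - 1.
Proof. by rewrite cosD; have := cos2Dsin2 x; lra. Qed.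

Lemma cos2piB (x : R) : cos (pi + pi - x) = cos x.
Proof. by rewrite -mulr2n cosB cos2pi sin2pi; ring. Qed.

Lemma cos_third : 2 * cosk 3 = -1.
Proof.
have /andP[_ c1] := @cosk_lt1 3 isT; set x := 2 * pi / 3%:R in c1 *.
have e : cos (x + x) = cos x by rewrite -[RHS]cos2piB; congr cos; rewrite /x; field.
rewrite cos2x in e; have : (2 * cos x + 1) * (cos x - 1) = 0 by lra.
by move/eqP; rewrite mulf_eq0 => /orP[] /eqP; lra.
Qed.

Lemma cos_fourth : 2 * cosk 4 = 0.
Proof. by rewrite -[RHS](mulr0 2) -cos_pihalf; congr (2 * cos _); field. Qed.

Lemma cos_sixth : 2 * cosk 6 = 1.
Proof.
have /andP[c1 _] := @cosk_lt1 6 isT; set x := 2 * pi / 6%:R in c1 *.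
have e : cos (x + x) = - cos x.
  have -> : x + x = pi - x by rewrite /x; field.
  by rewrite cosB cospi sinpi; ring.
rewrite cos2x in e; have : (2 * cos x - 1) * (cos x + 1) = 0 by lra.
by move/eqP; rewrite mulf_eq0 => /orP[] /eqP; lra.
Qed.

(** With [x] a fifth of a turn, [cos (3 x) = cos (2 x)] is a cubic equation in [cos x]; being
    positive and less than 1 leaves a single root. *)
Lemma cos_fifth (phi : R) : 0 < phi -> phi ^+ 2 = phi + 1 -> 2 * cosk 5 = phi - 1.
Proof.
move=> phi0 phi2; have /andP[_ c1] := @cosk_lt1 5 isT.
have phi1 := phi_gt1 phi0 phi2; have p0 := pi_gt0 R.
have c0 : 0 < cosk 5.
  by apply: cos_gt0_pihalf; apply/andP; split; lra.
have := cos2Dsin2 (2 * pi / 5%:R : R); set x := 2 * pi / 5%:R in c0 c1 * => cs.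
have e : cos (x + x + x) = cos (x + x).
  by rewrite -[RHS]cos2piB; congr cos; rewrite /x; field.
have e3 : cos (x + x + x) = 4 * cos x ^+ 3 - 3 * cos x.
  rewrite cosD sinD cos2x.
  transitivity ((2 * cos x ^+ 2 - 1) * cos x -
    2 * cos x * ((cos x ^+ 2 + sin x ^+ 2) - cos x ^+ 2)); first by ring.
  by rewrite cs; ring.
have : (cos x - 1) * (4 * cos x ^+ 2 + 2 * cos x - 1) = 0.
  rewrite e3 cos2x in e.
  transitivity (4 * cos x ^+ 3 - 3 * cos x - (2 * cos x ^+ 2 - 1)); first by ring.
  by rewrite e subrr.
move/eqP; rewrite mulf_eq0 => /orP[/eqP|/eqP q]; first by lra.
have : (2 * cos x - (phi - 1)) * (2 * cos x + phi) = 0.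
  transitivity (4 * cos x ^+ 2 + 2 * cos x - (phi ^+ 2 - phi)); first by ring.
  by rewrite phi2; lra.
by move/eqP; rewrite mulf_eq0 => /orP[] /eqP; lra.
Qed.

End Trigonometry.

(* In the pentagonal case the words of Z are a priori words in signed letters,
   so both languages are compared there. *)
Theorem theorem29 (R : realType) (c v : R * R) (hv : v <> 0) :
  [/\ language 3 c v = periodic_factors Z_triangle,
      language 4 c v = periodic_factors Z_square,
      language 6 c v = periodic_factors Z_hexagon &
      [set pos w | w in language 5 c v] =
        periodic_factors [set spell z | z in Z_pentagon]].
Proof.
have s5 : (Num.sqrt 5 : R) ^+ 2 = 5 by rewrite sqr_sqrtr.
have s0 : 0 <= (Num.sqrt 5 : R) by apply: sqrtr_ge0.
(* The same golden ratio serves all four computations; the distance tables of the first three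
   polygons only involve integers. *)
pose phi : R := (1 + Num.sqrt 5) / 2.
have phi_gt0 : 0 < phi by rewrite divr_gt0 //; lra.
have phi_sqr : phi ^+ 2 = phi + 1 by rewrite /phi; nra.
have ev_int m n : ev phi (zint m n) = m%:~R + n%:~R * phi.
  by rewrite /ev /zr /zint /= !Z_of_intK.
split.
- rewrite -periodic_triangle -(tri_language phi_gt0 phi_sqr).
  apply: (languageE _ _ hv phi_gt0 phi_sqr) => [//||]; last vm_check.
  by rewrite cos_third ev_int; ring.
- rewrite -periodic_square -(sq_language phi_gt0 phi_sqr).
  apply: (languageE _ _ hv phi_gt0 phi_sqr) => [//||]; last vm_check.
  by rewrite cos_fourth ev_int; ring.
- rewrite -periodic_hexagon -(hex_language phi_gt0 phi_sqr).
  apply: (languageE _ _ hv phi_gt0 phi_sqr) => [//||]; last vm_check.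
  by rewrite cos_sixth ev_int; ring.
- rewrite -periodic_pentagon -(pen_language phi_gt0 phi_sqr); congr image.
  apply: (languageE _ _ hv phi_gt0 phi_sqr) => [//||]; last vm_check.
  by rewrite (cos_fifth phi_gt0 phi_sqr) ev_int; ring.
Qed.
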